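(* Let $\theta\in\mathbb{R}$ and let $(G,o)$ be a unimodular random rooted graph with maximum degree at most $D$. If $G$ is $\theta$-critical with probability $1$, then $G$ is finite with probability $1$.
   Context: Matching measure: for a graph $G$ of maximum degree at most $D$ and vertex $u$, $\nu_{G,u}$ is the spectral measure at the one-vertex path $u$ of the adjacency operator of the path tree $T(G,u)$ (vertices: finite paths in $G$ starting at $u$; two paths adjacent iff one is obtained from the other by deleting its last vertex). A vertex $u$ is $\theta$-essential if $\nu_{G,u}(\{\theta\})>0$; $G$ is $\theta$-critical if all its vertices are $\theta$-essential. A random rooted (connected) graph $(G,o)$ is unimodular if for every non-negative measurable $f$ on bi-rooted graphs, $\mathbb{E}\sum_{v} f(G,o,v)=\mathbb{E}\sum_{v}f(G,v,o)$. *)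

(* Defs.v *)
From HB Require Import structures.
From mathcomp Require Import all_boot all_order all_algebra.
From mathcomp Require Import all_classical all_reals all_analysis.
From mathcomp Require Import measurable_realfun.
Set Implicit Arguments. Unset Strict Implicit. Unset Printing Implicit Defensive.
Import Order.TTheory GRing.Theory Num.Theory.
Local Open Scope classical_set_scope.
Local Open Scope ring_scope.

(* A (simple, locally countable) graph is encoded by a relation on nat;
   the adjacency is its symmetrised, loop-free version.  The rooted graph
   (G,o) is the connected component of the root (o = 0 for random rooted
   graphs); vertices outside that component are ignored.                   *)
Definition graph := nat -> nat -> bool.

Definition adj (G : graph) : rel nat :=
  fun x y => (x != y) && (G x y || G y x).

Definition comp (G : graph) (a : nat) : set nat :=
  [set v | exists s : seq nat, path (adj G) a s /\ last a s = v].

Definition max_deg_le (D : nat) (G : graph) (a : nat) : Prop :=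
  forall v, comp G a v ->
    forall s : seq nat, uniq s -> all (adj G v) s -> (size s <= D)%N.

Definition birooted_iso (G : graph) (a b : nat) (G' : graph) (a' b' : nat) :
  Prop :=
  exists phi : nat -> nat,
    (forall v, comp G a v -> comp G' a' (phi v)) /\
    (forall w, comp G' a' w -> exists2 v, comp G a v & phi v = w) /\
    (forall v w, comp G a v -> comp G a w -> phi v = phi w -> v = w) /\
    (forall v w, comp G a v -> comp G a w -> adj G' (phi v) (phi w) = adj G v w) /\
    phi a = a' /\ phi b = b'.

Definition graph_cyl : set (set graph) :=
  [set A | exists i j (c : bool), A = [set G | G i j = c]].
Notation graphM := (g_sigma_algebraType graph_cyl).

Definition bigraph := (graph * nat * nat)%type.
Definition bigraph_cyl : set (set bigraph) :=
  [set A | (exists i j (c : bool), A = [set x | x.1.1 i j = c])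
        \/ (exists n, A = [set x | x.1.2 = n])
        \/ (exists n, A = [set x | x.2 = n])].
Notation bigraphM := (g_sigma_algebraType bigraph_cyl).

Definition iso_invariant (R : realType) (f : bigraph -> \bar R) : Prop :=
  forall G a b G' a' b', comp G a b -> birooted_iso G a b G' a' b' ->
    f (G, a, b) = f (G', a', b').

Definition unimodular (R : realType) (P : probability graphM R) : Prop :=
  forall f : bigraphM -> \bar R,
    measurable_fun [set: bigraphM] f -> (forall x, (0 <= f x)%E) ->
    iso_invariant (f : bigraph -> \bar R) ->
    (\int[P]_G (\sum_(v <oo) (if v \in comp G 0 then f (G, 0%N, v) else 0%E)))%E
    = (\int[P]_G (\sum_(v <oo) (if v \in comp G 0 then f (G, v, 0%N) else 0%E)))%E.

(* Vertices of the path tree T(G,u): self-avoiding paths u = x_0, ..., x_m,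
   stored reversed as [:: x_m; ...; x_0].  The parent of a path is obtained by
   deleting its last vertex (behead), its children by appending a neighbour of
   x_m not on the path.  [tree_walks G u k p] = number of walks of length k in
   T(G,u) from p to the one-vertex path [:: u].                              *)
Fixpoint tree_walks (R : realType) (G : graph) (u : nat) (k : nat)
  (p : seq nat) {struct k} : \bar R :=
  match k with
  | 0 => if p == [:: u] then 1%E else 0%E
  | k'.+1 =>
      ((if (1 < size p)%N then tree_walks R G u k' (behead p) else 0%E)
      + \sum_(x <oo) (if adj G (head u p) x && (x \notin p)
                      then tree_walks R G u k' (x :: p) else 0%E))%E
  end.

(* the k-th moment <A^k d_u, d_u> of the adjacency operator of T(G,u) at the
   root = number of closed walks of length k at the root of T(G,u) *)
Definition path_tree_moment (R : realType) (G : graph) (u k : nat) : \bar R :=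
  tree_walks R G u k [:: u].

(* nu is the matching measure nu_{G,u}: the spectral measure of the (bounded,
   self-adjoint, for bounded degree) adjacency operator of T(G,u) at the root,
   i.e. the (unique, compactly supported) probability measure on R whose
   moments are <A^k d_u, d_u>. *)
Definition is_matching_measure (R : realType) (G : graph) (u : nat)
  (nu : probability R R) : Prop :=
  forall k : nat,
    nu.-integrable setT (fun x : R => (x ^+ k)%:E) /\
    (\int[nu]_x (x ^+ k)%:E)%E = path_tree_moment R G u k.

Definition essential (R : realType) (theta : R) (G : graph) (u : nat) : Prop :=
  exists nu : probability R R, is_matching_measure G u nu /\ (0 < nu [set theta])%E.

Definition critical (R : realType) (theta : R) (G : graph) : Prop :=
  forall u, comp G 0 u -> essential theta G u.

Definition finite_graph (G : graph) : Prop := finite_set (comp G 0).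

(* Main.v *)
Require Import Defs.
From HB Require Import structures.
From mathcomp Require Import all_boot all_order all_algebra finmap.
From mathcomp Require Import all_classical all_reals all_analysis.
From mathcomp Require Import measurable_realfun.
From mathcomp Require Import complex ring lra.
Set Implicit Arguments. Unset Strict Implicit. Unset Printing Implicit Defensive.
Import Order.TTheory GRing.Theory Num.Theory.
Import numFieldNormedType.Exports.
Local Open Scope classical_set_scope.
Local Open Scope fset_scope.
Local Open Scope ring_scope.

(* For finite S put r(S, u) = i eta phi(S - u) / phi(S) at z = theta + i eta,
   where phi is the matching polynomial: this is i eta times the resolvent of
   the path tree at its root, and it tends to the atom nu_{S,u}({theta}) as
   eta -> 0.  Polarised Heilmann--Lieb identities, the Ward identity
   eta sum_P |phi(S - P)|^2 = Im (phi(S) conj phi(S - u)) and the reversal of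
   paths give inequalities that are uniform in S, so they survive the exhaustion
   S = {0, .., n-1}, n -> oo, of an infinite graph followed by eta -> 0.
   If all atoms are positive, the relation "the atom of G - u at v vanishes"
   contains adjacency and is transitive, so it holds for all u != v by
   connectedness (Gallai's lemma).  Hence p_u sum_v p_v <= p_u for the atoms
   p_v, up to a constant lost by working with p_v / 2.  Transporting mass p_v
   from u to v, the expected mass sent is bounded, while the expected mass
   received is E (|G| p_o); so G is finite almost surely. *)

(** The obstacle is that criticality supplies measures for G only, never for G - u. For the atoms of
    G lower bounds suffice, and they come from moments: Cauchy--Schwarz on the finite path tree,
    tested against q(A) delta_u, involves finitely many walk counts, which agree with those of G
    once S is large. With q a high power of a polynomial peaked at theta the bound approaches the
    whole atom; the power has to be fixed before n and eta move, whence the half. Transitivity needs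
    more than the classical identity: the polarised one involves phi(S') phi(S' + x) over paths from
    u to y. One factor is controlled by u in S; the other, after reversal, by y in S - x. Mass
    transport requires a measurable, isomorphism-invariant function of every graph, whereas
    [essential] only asserts that some measure exists. This is why the atom is recomputed from walk
    counts as an upper limit. *)

Local Notation comp := Defs.comp.
Local Notation Re := complex.Re.
Local Notation Im := complex.Im.

(** * Matching polynomials and self-avoiding paths of finite graphs *)

Section FiniteSets.
Variable T : choiceType.
Implicit Types (S : {fset T}) (u v w : T).

Lemma fsetDAC1 S u v : S `\ u `\ v = S `\ v `\ u.
Proof. by rewrite fsetDDl fsetUC -fsetDDl. Qed.

Lemma cardfsD1_le S u k : u \in S -> (#|` S| <= k.+1)%N = (#|` S `\ u| <= k)%N.
Proof. by move=> uS; rewrite (cardfsD1 u) uS. Qed.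

Lemma fproper_ind (P : {fset T} -> Prop) :
  (forall S, (forall S', S' `<` S -> P S') -> P S) -> forall S, P S.
Proof.
move=> IH S; have [k] := ubnP #|` S|; elim: k S => // k IHk S leSk.
by apply: IH => S' ltS; apply: IHk; rewrite (leq_trans (fproper_ltn_card ltS)).
Qed.

Lemma fproperD1_sub S S' u : S' `<=` S -> u \in S' -> S' `\ u `<` S.
Proof. by move=> sS uS'; apply: fproper_sub_trans sS; apply: fproperD1. Qed.

Lemma big_fsetD1_cond (V : nmodType) S w (P : pred T) (F : T -> V) :
  \sum_(y <- S `\ w | P y) F y = \sum_(y <- S | (y != w) && P y) F y.
Proof.
have [wS|wS] := boolP (w \in S); last first.
  rewrite mem_fsetD1 // big_seq_cond [RHS]big_seq_cond; apply: eq_bigl => y.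
  by case: eqVneq => [->|]; rewrite ?(negPf wS).
rewrite [RHS]big_mkcond (big_fsetD1 w) //= eqxx add0r -big_mkcond /=.
rewrite big_seq_cond [RHS]big_seq_cond; apply: eq_bigl => y.
by rewrite !inE; case: (y == w).
Qed.

End FiniteSets.

Section MatchingPolynomial.
Variables (T : choiceType) (e : rel T).
Implicit Types (S : {fset T}) (u v w x : T).

Section Neighbours.
Variable V : nmodType.
Definition nsum S u (F : T -> V) : V := \sum_(w <- S | e u w) F w.

Lemma eq_nsum S u F F' : (forall w, w \in S -> e u w -> F w = F' w) ->
  nsum S u F = nsum S u F'.
Proof.
move=> h; rewrite /nsum big_seq_cond [RHS]big_seq_cond.
by apply: eq_bigr => w /andP[wS uw]; apply: h.
Qed.

Lemma nsumD1 S u v F : v \in S ->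
  nsum S u F = (if e u v then F v else 0) + nsum (S `\ v) u F.
Proof. by move=> vS; rewrite /nsum !(big_mkcond (e u)) (big_fsetD1 v). Qed.

Lemma nsum_pairC S u v (F : T -> T -> V) :
  nsum S u (fun w => nsum (S `\ w) v (F w)) =
  nsum S v (fun y => nsum (S `\ y) u (F^~ y)).
Proof.
rewrite /nsum; under eq_bigr do rewrite big_fsetD1_cond.
under [RHS]eq_bigr do rewrite big_fsetD1_cond.
rewrite (exchange_big_dep (e v)) /=; last by move=> ? ? _ /andP[].
apply: eq_bigr => y vy; apply: eq_bigl => w.
by rewrite vy andbT andbC eq_sym.
Qed.
End Neighbours.

Section Phi.
Variables (K : comRingType) (z : K).

(** The matching polynomial at [z], expanded at the vertex that the enumeration of [S] lists first.
    [k] is fuel; [phiE] frees the expansion from that choice. *)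
Fixpoint phi_rec k S : K :=
  if k is k'.+1 then
    if enum_fset S is u :: _ then
      z * phi_rec k' (S `\ u) - nsum (S `\ u) u (fun w => phi_rec k' (S `\ u `\ w))
    else 1
  else 1.

Definition phi S := phi_rec #|` S| S.

Lemma phi_rec_fuel k k' S : (#|` S| <= k)%N -> (#|` S| <= k')%N ->
  phi_rec k S = phi_rec k' S.
Proof.
elim: k k' S => [|k IHk] [|k'] S //=.
- by rewrite leqn0 cardfs_eq0 => /eqP ->.
- by rewrite leqn0 cardfs_eq0 => _ /eqP ->.
move=> lek lek'; case E : (enum_fset S) => [//|u s].
have uS : u \in S by change (u \in enum_fset S); rewrite E inE eqxx.
move: lek lek'; rewrite !(cardfsD1_le _ uS) => lek lek'.
congr (_ * _ - _); first exact: IHk.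
apply: eq_nsum => w wS _; apply: IHk.
  by rewrite (leq_trans _ lek) ?fsubset_leq_card ?fsubD1set.
by rewrite (leq_trans _ lek') ?fsubset_leq_card ?fsubD1set.
Qed.

Lemma phi0 : phi fset0 = 1.
Proof. by rewrite /phi cardfs0. Qed.

Lemma phi_pick S u s : enum_fset S = u :: s ->
  phi S = z * phi (S `\ u) - nsum (S `\ u) u (fun w => phi (S `\ u `\ w)).
Proof.
move=> E; have uS : u \in S by change (u \in enum_fset S); rewrite E inE eqxx.
rewrite {1}/phi (cardfsD1 u) uS add1n /= E; congr (_ - _).
apply: eq_nsum => w wS _; apply: phi_rec_fuel => //.
by rewrite fsubset_leq_card ?fsubD1set.
Qed.

Hypothesis e_sym : symmetric e.

(** Expanding at the listed vertex [a] and then at [u] yields the same terms as in the other order;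
    the inner expansions concern smaller sets, where the induction hypothesis allows any vertex. *)
Lemma phiE S u : u \in S ->
  phi S = z * phi (S `\ u) - nsum (S `\ u) u (fun w => phi (S `\ u `\ w)).
Proof.
elim/fproper_ind: S u => S IH u uS.
case E : (enum_fset S) => [|a s].
  by have : u \in enum_fset S by []; rewrite E.
have aS : a \in S by change (a \in enum_fset S); rewrite E inE eqxx.
have [->|ua] := eqVneq u a; first exact: phi_pick E.
rewrite (phi_pick E) {E s}.
have expand b c : b \in S -> c \in S -> c != b ->
  z * phi (S `\ b) - nsum (S `\ b) b (fun w => phi (S `\ b `\ w)) =
  z * (z * phi (S `\ b `\ c)
    - nsum (S `\ b `\ c) c (fun w => phi (S `\ b `\ c `\ w)))
  - (if e b c then phi (S `\ b `\ c) else 0) -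
  (z * nsum (S `\ b `\ c) b (fun w => phi (S `\ b `\ c `\ w))
   - nsum (S `\ b `\ c) b (fun w => nsum (S `\ b `\ c `\ w) c
        (fun y => phi (S `\ b `\ c `\ w `\ y)))).
  move=> bS cS cb; have cSb : c \in S `\ b by rewrite !inE cb.
  rewrite (IH _ _ c cSb) ?fproperD1 // (nsumD1 _ _ cSb) opprD addrA; congr (_ - _).
  rewrite /nsum mulr_sumr -sumrB; apply: eq_nsum => w.
  rewrite !inE => /and3P[wc wb wS] _; rewrite (fsetDAC1 _ c).
  have wSb : w \in S `\ b by rewrite !inE wb.
  rewrite (IH _ (fproperD1_sub (fsubD1set _ _) wSb) c) ?inE 1?eq_sym ?wc ?cb //.
rewrite (expand a u) // (expand u a) 1?eq_sym // (fsetDAC1 _ u) (e_sym u) nsum_pairC.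
set A := nsum _ u (fun y => nsum _ a _).
rewrite (_ : nsum _ u (fun w => nsum _ a _) = A); last first.
  by apply: eq_nsum => w _ _; apply: eq_nsum => y _ _; rewrite (fsetDAC1 _ w).
ring.
Qed.

End Phi.

Fixpoint paths_rec k S u q : seq ({fset T} * seq T) :=
  (S, u :: q) ::
  if k is k'.+1 then
    flatten [seq paths_rec k' (S `\ w) w (u :: q) | w <- S & e u w]
  else [::].

Definition paths S u q := paths_rec #|` S| S u q.

Lemma paths_rec_fuel k k' S u q : (#|` S| <= k)%N -> (#|` S| <= k')%N ->
  paths_rec k S u q = paths_rec k' S u q.
Proof.
have emp j : paths_rec j fset0 u q = [:: (fset0, u :: q)].
  by case: j => //= j; rewrite -[X in flatten X]/[::].
elim: k k' S u q emp => [|k IHk] [|k'] S u q emp //.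
- by rewrite leqn0 cardfs_eq0 => /eqP ->; rewrite !emp.
- by rewrite leqn0 cardfs_eq0 => _ /eqP ->; rewrite !emp.
move=> lek lek' /=; congr (_ :: flatten _); apply/eq_in_map => w.
rewrite mem_filter => /andP[_ wS]; apply: IHk; rewrite -?cardfsD1_le //.
by case => //= j; rewrite -[X in flatten X]/[::].
Qed.

Lemma pathsE S u q : paths S u q =
  (S, u :: q) :: flatten [seq paths (S `\ w) w (u :: q) | w <- S & e u w].
Proof.
rewrite {1}/paths; case E: #|` S| => [|k] /=.
  by move/eqP: E; rewrite cardfs_eq0 => /eqP ->.
congr (_ :: flatten _); apply/eq_in_map => w.
rewrite mem_filter => /andP[_ wS]; apply: paths_rec_fuel => //.
by rewrite -cardfsD1_le // E.
Qed.

Section PathSums.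
Variable V : nmodType.

Definition psum S u q (F : {fset T} -> seq T -> V) : V := \sum_(P <- paths S u q) F P.1 P.2.

Lemma psumE S u q F :
  psum S u q F = F S (u :: q) + nsum S u (fun w => psum (S `\ w) w (u :: q) F).
Proof.
rewrite /psum pathsE big_cons big_flatten big_map big_filter; congr (_ + _).
Qed.

Lemma psum_head S u q q' (F : {fset T} -> V) :
  psum S u q (fun S' _ => F S') = psum S u q' (fun S' _ => F S').
Proof.
elim/fproper_ind: S u q q' => S IH u q q'; rewrite psumE [RHS]psumE; congr (_ + _).
by apply: eq_nsum => w wS _; apply: IH; apply: fproperD1.
Qed.

Definition ends v (p : seq T) := ohead p == Some v.

Definition psum_to S u v (F : {fset T} -> V) : V :=
  psum S u [::] (fun S' p => if ends v p then F S' else 0).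

Lemma psum_toE S u q v (F : {fset T} -> V) :
  psum S u q (fun S' p => if ends v p then F S' else 0) = psum_to S u v F.
Proof.
suff h q' : psum S u q (fun S' p => if ends v p then F S' else 0) =
  psum S u q' (fun S' p => if ends v p then F S' else 0) by exact: h.
elim/fproper_ind: S u q q' => S IH u q q'; rewrite psumE [RHS]psumE; congr (_ + _).
by apply: eq_nsum => w wS _; apply: IH; apply: fproperD1.
Qed.

Lemma psum_to_rec S u v (F : {fset T} -> V) :
  psum_to S u v F = (if u == v then F S else 0) +
  nsum S u (fun w => psum_to (S `\ w) w v F).
Proof.
rewrite /psum_to psumE; congr (_ + _).
by apply: eq_nsum => w _ _; rewrite psum_toE.
Qed.

Lemma psum_to_notin S u v (F : {fset T} -> V) : v != u -> v \notin S -> psum_to S u v F = 0.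
Proof.
elim/fproper_ind: S u => S IH u vu vS; rewrite psum_to_rec eq_sym (negPf vu) add0r.
rewrite /nsum big_seq_cond big1 // => w /andP[wS _]; apply: IH.
- exact: fproperD1.
- by apply: contraNneq vS => ->.
- by rewrite !inE negb_and vS orbT.
Qed.

Lemma psum_to_self S u (F : {fset T} -> V) : u \notin S -> psum_to S u u F = F S.
Proof.
move=> uS; rewrite psum_to_rec eqxx /nsum big_seq_cond big1 ?addr0 //.
move=> w /andP[wS _]; apply: psum_to_notin.
  by apply: contraNneq uS => ->.
by rewrite !inE negb_and uS orbT.
Qed.

Lemma psum_to_step S u v (F : {fset T} -> V) : u != v -> v \in S -> 
  psum_to S u v F = (if e u v then F (S `\ v) else 0) +
   nsum (S `\ v) u (fun w => psum_to (S `\ w) w v F).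
Proof.
move=> uv vS; rewrite psum_to_rec (negPf uv) add0r (nsumD1 _ _ vS).
by rewrite psum_to_self // !inE eqxx.
Qed.

Hypothesis e_sym : symmetric e.

Lemma psum_to_rev S u v (F : {fset T} -> V) : u \in S -> v \in S ->
  psum_to (S `\ u) u v F = psum_to (S `\ v) v u F.
Proof.
elim/fproper_ind: S u v => S IH u v uS vS.
have [->//|uv] := eqVneq u v; have vu : v != u by rewrite eq_sym.
have expand a b : a \in S -> b \in S -> a != b ->
  psum_to (S `\ a) a b F = (if e a b then F (S `\ a `\ b) else 0) +
  (nsum (S `\ a `\ b) a (fun w => if e b w then F (S `\ a `\ b `\ w) else 0) +
   nsum (S `\ a `\ b) a (fun w => nsum (S `\ a `\ b `\ w) b (fun y =>
     psum_to (S `\ a `\ b `\ y) y w F))).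
  move=> aS bS ab; have bSa : b \in S `\ a by rewrite !inE eq_sym ab.
  rewrite psum_to_step //; congr (_ + _); rewrite /nsum -big_split.
  apply: eq_nsum => w; rewrite !inE => /and3P[wb wa wS] _.
  rewrite IH ?fproperD1 // ?inE ?wa // psum_to_step ?inE ?wa ?wb // eq_sym //.
rewrite (expand u v) // (expand v u) // (fsetDAC1 _ v u) (e_sym v).
congr (_ + (_ + _)).
  rewrite /nsum -[LHS]big_mkcondr -[RHS]big_mkcondr.
  by apply: eq_bigl => w; rewrite andbC.
rewrite nsum_pairC; apply: eq_nsum => y; rewrite !inE => /and3P[yv yu yS] _.
apply: eq_nsum => w; rewrite !inE => /and4P[wy wv wu wS] _.
rewrite IH // ?inE ?wu ?wv ?wS ?yv ?yu ?yS //.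
by rewrite (fproper_sub_trans (fproperD1 _) (fsubD1set _ u)) // !inE vu.
Qed.
End PathSums.

(** * Heilmann--Lieb identities as sums over the paths between two vertices *)

Section HeilmannLieb.
Variables (K : comRingType) (z : K) (c : T -> K) (S0 : {fset T}).
Variables a b : {fset T} -> K.
Hypothesis aE : forall S u, S `<=` S0 -> u \in S ->
  a S = z * a (S `\ u) - nsum (S `\ u) u (fun w => a (S `\ u `\ w)).
Hypothesis bE : forall S u, S `<=` S0 -> u \in S ->
  b S = z * b (S `\ u) - c u * a (S `\ u)
        - nsum (S `\ u) u (fun w => b (S `\ u `\ w)).

(* Polarised Heilmann--Lieb identity; [a = b = phi] is the classical one and
   [b S = phi (x |` S)] its derivative in the weight of the vertex [x]. *)
Lemma Heilmann_Lieb S u v : S `<=` S0 -> u \in S -> v \in S -> u != v ->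
  psum_to (S `\ u) u v (fun S' => a S' * b S') *+ 2 =
  a (S `\ u) * b (S `\ v) + b (S `\ u) * a (S `\ v)
  - a S * b (S `\ u `\ v) - b S * a (S `\ u `\ v).
Proof.
elim/fproper_ind: S u v => S IH u v sS uS vS uv.
have vSu : v \in S `\ u by rewrite !inE eq_sym uv.
have uSv : u \in S `\ v by rewrite !inE uv.
rewrite psum_to_step // mulrnDl.
have -> : nsum (S `\ u `\ v) u
     (fun w => psum_to (S `\ u `\ w) w v (fun S' => a S' * b S')) *+ 2 =
  b (S `\ u `\ v) * nsum (S `\ u `\ v) u (fun w => a (S `\ u `\ w))
  + a (S `\ u `\ v) * nsum (S `\ u `\ v) u (fun w => b (S `\ u `\ w))
  - a (S `\ u) * nsum (S `\ u `\ v) u (fun w => b (S `\ u `\ v `\ w))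
  - b (S `\ u) * nsum (S `\ u `\ v) u (fun w => a (S `\ u `\ v `\ w)).
  rewrite /nsum -sumrMnl !mulr_sumr -big_split -!sumrB /=; apply: eq_nsum => w.
  rewrite !inE => /and3P[wv wu wS] _.
  rewrite IH ?fproperD1 ?inE ?wu // 1?eq_sym // ?uv ?(fsubset_trans (fsubD1set _ _)) //.
  rewrite (fsetDAC1 _ w v). ring.
(* Only [S] and S - v are expanded, both at [u]; the terms in [c u] coming from b(S) and b(S - v)
   cancel. *)
have Ea := aE sS uS; have Eb := bE sS uS.
rewrite !(nsumD1 _ _ vSu) in Ea Eb.
have sSv : S `\ v `<=` S0 := fsubset_trans (fsubD1set _ _) sS.
have Eav := aE sSv uSv; have Ebv := bE sSv uSv.
rewrite !(fsetDAC1 _ v u) in Eav Ebv.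
rewrite Ea Eb Eav Ebv; case: (e u v); ring.
Qed.
End HeilmannLieb.

(** * Symmetry and Green's identity for the path tree *)

Section Green.
Variables (K : comRingType) (u0 : T).

Definition par (f : seq T -> K) p := if (1 < size p)%N then f (behead p) else 0.

(* The adjacency operator of the path tree, at the path [p] whose unused
   vertices are [S]. *)
Definition tree_adj S p f := par f p + nsum S (head u0 p) (fun x => f (x :: p)).

(** Every edge inside the subtree below [u :: q] contributes twice with opposite signs, so only the
    edge to the parent survives. At the root, where [par] is 0, the operator is symmetric. *)
Lemma tree_adj_sym S u q f g :
  psum S u q (fun S' p => f p * tree_adj S' p g - g p * tree_adj S' p f) =
  f (u :: q) * par g (u :: q) - g (u :: q) * par f (u :: q).
Proof.
elim/fproper_ind: S u q => S IH u q; rewrite psumE.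
rewrite (_ : nsum S u _ = g (u :: q) * nsum S u (fun x => f (x :: u :: q))
   - f (u :: q) * nsum S u (fun x => g (x :: u :: q))).
  by rewrite /tree_adj /=; ring.
rewrite /nsum !mulr_sumr -sumrB; apply: eq_nsum => w wS _.
by rewrite IH ?fproperD1 // /par /=; ring.
Qed.

Hypothesis e_sym : symmetric e.
Variable z : K.
Local Notation phi := (phi z).

(** Divided by phi of all vertices, [phi S'] as a function of the path is the root column of the
    resolvent of the path tree. This is that fact tested against [f], with a boundary term at the
    parent. *)
Lemma tree_Green S u q f : u \notin S ->
  psum S u q (fun S' p => phi S' * (z * f p - tree_adj S' p f)) =
  phi (u |` S) * f (u :: q) - phi S * par f (u :: q).
Proof.
elim/fproper_ind: S u q => S IH u q uS; rewrite psumE.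
rewrite (@phiE _ z e_sym (u |` S) u) ?fset1U1 // fsetU1K //.
rewrite (_ : nsum S u (fun w => psum _ _ _ _) =
   phi S * nsum S u (fun x => f (x :: u :: q))
   - f (u :: q) * nsum S u (fun x => phi (S `\ x))).
  by rewrite /tree_adj /=; ring.
rewrite /nsum !mulr_sumr -sumrB; apply: eq_nsum => w wS _.
by rewrite IH ?fproperD1 ?fsetD11 // fsetD1K // /par /=; ring.
Qed.
End Green.

End MatchingPolynomial.

(** * The resolvent of a finite path tree *)

Section ComplexNorm.
Local Open Scope complex_scope.
Local Open Scope ring_scope.
Variable R : rcfType.
Implicit Types a b : R[i].

Definition cabs a : R := Re `|a|.
Definition cabs2 a : R := Re a ^+ 2 + Im a ^+ 2.

Lemma cabsE a : `|a| = (cabs a)%:C.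
Proof. by case: a. Qed.

Lemma cabs_sqr a : cabs a ^+ 2 = cabs2 a.
Proof. by case: a => x y; rewrite /cabs /cabs2 /= sqr_sqrtr // addr_ge0 ?sqr_ge0. Qed.

Lemma cabs_ge0 a : 0 <= cabs a.
Proof. by case: a => x y; rewrite /cabs /= sqrtr_ge0. Qed.

Lemma cabsM a b : cabs (a * b) = cabs a * cabs b.
Proof. by apply: (@complexI R); rewrite rmorphM -!cabsE normrM. Qed.

Lemma cabsV a : cabs a^-1 = (cabs a)^-1.
Proof. by apply: (@complexI R); rewrite fmorphV -!cabsE normfV. Qed.

Lemma cabsX a n : cabs (a ^+ n) = cabs a ^+ n.
Proof. by apply: (@complexI R); rewrite rmorphXn -!cabsE normrX. Qed.

Lemma cabsMn a n : cabs (a *+ n) = cabs a *+ n.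
Proof. by apply: (@complexI R); rewrite rmorphMn -!cabsE normrMn. Qed.

Lemma cabsN a : cabs (- a) = cabs a.
Proof. by apply: (@complexI R); rewrite -!cabsE normrN. Qed.

Lemma cabsD a b : cabs (a + b) <= cabs a + cabs b.
Proof. by rewrite -lecR rmorphD -!cabsE ler_normD. Qed.

Lemma cabs0 : cabs 0 = 0.
Proof. by apply: (@complexI R); rewrite -cabsE normr0. Qed.

Lemma cabs_gt0 a : (0 < cabs a) = (a != 0).
Proof. by rewrite -ltcR -cabsE normr_gt0. Qed.

Lemma cabs_sum I (r : seq I) (P : pred I) (F : I -> R[i]) :
  cabs (\sum_(i <- r | P i) F i) <= \sum_(i <- r | P i) cabs (F i).
Proof.
elim/big_rec2: _ => [|i x y _ le]; first by rewrite cabs0.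
by rewrite (le_trans (cabsD _ _)) // lerD2l.
Qed.

Lemma Re_le_cabs a : Re a <= cabs a.
Proof.
case: a => x y; rewrite /cabs /= (le_trans (ler_norm _)) // -sqrtr_sqr.
by rewrite ler_wsqrtr // lerDl sqr_ge0.
Qed.

Lemma Im_le_cabs a : Im a <= cabs a.
Proof.
case: a => x y; rewrite /cabs /= (le_trans (ler_norm _)) // -sqrtr_sqr.
by rewrite ler_wsqrtr // lerDr sqr_ge0.
Qed.

End ComplexNorm.

Section CauchySchwarz.
Variables (R : realFieldType) (I : Type) (r : seq I).
Lemma Cauchy_Schwarz_seq (F G : I -> R) :
  (\sum_(i <- r) F i * G i) ^+ 2 <=
  (\sum_(i <- r) F i ^+ 2) * (\sum_(i <- r) G i ^+ 2).
Proof.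
set A := \sum_(i <- r) F i ^+ 2; set B := \sum_(i <- r) G i ^+ 2.
set C := \sum_(i <- r) _.
have h (x y : R) : 0 <= x ^+ 2 * A + y ^+ 2 * B + 2 * x * y * C.
  rewrite /A /B /C !mulr_sumr -!big_split /= sumr_ge0 // => i _.
  by rewrite (_ : _ + _ = (x * F i + y * G i) ^+ 2) ?sqr_ge0 //; ring.
have A0 : 0 <= A by apply: sumr_ge0 => i _; apply: sqr_ge0.
have B0 : 0 <= B by apply: sumr_ge0 => i _; apply: sqr_ge0.
have := h B (- C).
have [|] := ltP 0 B.
  move=> B_gt0 hB; have : 0 <= B * (A * B - C ^+ 2) by move: hB; congr (_ <= _); ring.
  by rewrite pmulr_rge0 // subr_ge0.
move=> Bn; have -> : B = 0 by apply/eqP; rewrite eq_le Bn B0.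
(* With B = 0 the form at this point equals - C^2 (A + 2), which forces C = 0. *)
have := h C (- (A + 1)); nra.
Qed.
End CauchySchwarz.

Section Resolvent.
Local Open Scope complex_scope.
Local Open Scope ring_scope.
Variables (R : rcfType) (T : choiceType) (e : rel T).
Hypothesis e_sym : symmetric e.
Variables (theta eta : R).
Hypothesis eta_gt0 : 0 < eta.
Implicit Types (S : {fset T}) (u v w x : T).
Let z : R[i] := theta +i* eta.
Local Notation phi := (phi e z).
Local Notation psum := (psum e).
Local Notation psum_to := (psum_to e).

(** The imaginary part of [a] times the conjugate of [b]. *)
Definition im2 (a b : R[i]) : R := Im a * Re b - Re a * Im b.

Lemma im2_sumr I (s : seq I) (P : pred I) a (F : I -> R[i]) :
  im2 a (\sum_(i <- s | P i) F i) = \sum_(i <- s | P i) im2 a (F i).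
Proof.
elim/big_rec2: _ => [|i x y _ <-]; first by rewrite /im2 /= !mulr0 subr0.
by case: a (F i) y => a1 a2 [f1 f2] [y1 y2]; rewrite /im2 /=; ring.
Qed.

(** Expand at [u]: the imaginary part of [z] produces the term of the one-vertex path, and by
    antisymmetry of [im2] each neighbour term is the same identity one step further along the
    path. *)
Lemma Ward S u q : u \notin S ->
  eta * psum S u q (fun S' _ => cabs2 (phi S')) = im2 (phi (u |` S)) (phi S).
Proof.
elim/fproper_ind: S u q => S IH u q uS; rewrite psumE.
rewrite (@phiE _ _ _ z e_sym (u |` S) u) ?fset1U1 // fsetU1K //.
set s := nsum _ _ _ (fun w => phi _).
have -> : im2 (z * phi S - s) (phi S) = eta * cabs2 (phi S) + im2 (phi S) s.
  by case: (phi S) s => x y [s1 s2]; rewrite /im2 /cabs2 /=; ring.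
rewrite mulrDr /s /nsum im2_sumr mulr_sumr; congr (_ + _).
by apply: eq_nsum => w wS _; rewrite IH ?fproperD1 ?fsetD11 // fsetD1K.
Qed.

Lemma psum_cabs2_ge S u q : cabs2 (phi S) <= psum S u q (fun S' _ => cabs2 (phi S')).
Proof.
rewrite psumE lerDl; apply: sumr_ge0 => w _; apply: sumr_ge0 => P _.
by rewrite -cabs_sqr sqr_ge0.
Qed.

(** If phi(S) were 0, the Ward sum at a vertex [u] of [S] would vanish, although it contains the
    positive term |phi(S - u)|^2. *)
Lemma phi_neq0 S : phi S != 0.
Proof.
elim/fproper_ind: S => S IH; have [->|[u uS]] := fset_0Vmem S.
  by rewrite phi0 oner_neq0.
apply/negP => /eqP S0; have := @Ward (S `\ u) u [::] (negbT (fsetD11 _ _)).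
rewrite fsetD1K // S0 /im2 /= !mul0r subr0 => /eqP; rewrite mulf_eq0 gt_eqF //=.
have := psum_cabs2_ge (S `\ u) u [::]; rewrite -cabs_sqr => h.
by rewrite gt_eqF // (lt_le_trans _ h) // exprn_gt0 // cabs_gt0 IH ?fproperD1.
Qed.

(* [i eta] times the diagonal entry at [u] of the resolvent of the path tree *)
Definition res S u : R[i] := (0 +i* eta) * phi (S `\ u) / phi S.

Lemma Re_resE S u : u \in S -> Re (res S u) =
  eta ^+ 2 * psum (S `\ u) u [::] (fun S' _ => cabs2 (phi S')) / cabs2 (phi S).
Proof.
move=> uS; rewrite expr2 -(mulrA eta) Ward ?fsetD11 // fsetD1K //.
rewrite /res /im2 /cabs2; case: (phi S) (phi (S `\ u)) => a b [c d] /=; ring.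
Qed.

(** The real part is the whole Ward sum, the squared modulus its term for the one-vertex path. A
    nonnegative real part and a modulus at most 1 follow. *)
Lemma res_sqr_le S u : u \in S -> cabs (res S u) ^+ 2 <= Re (res S u).
Proof.
move=> uS; rewrite Re_resE // /res !cabsM cabsV !exprMn exprVn !cabs_sqr.
rewrite {1}/cabs2 /= expr0n add0r ler_wpM2r ?invr_ge0 -?cabs_sqr ?sqr_ge0 //.
by rewrite ler_wpM2l ?sqr_ge0 // cabs_sqr psum_cabs2_ge.
Qed.

Lemma Re_res_ge0 S u : u \in S -> 0 <= Re (res S u).
Proof. by move=> uS; rewrite (le_trans _ (res_sqr_le uS)) ?sqr_ge0. Qed.

Lemma cabs_res_le1 S u : u \in S -> cabs (res S u) <= 1.
Proof.
move=> uS; have := le_trans (res_sqr_le uS) (Re_le_cabs _).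
have := cabs_ge0 (res S u); nra.
Qed.

Lemma cabs_resM_le1 S S' u v : u \in S -> v \in S' ->
  cabs (res S u * res S' v) <= 1.
Proof. by move=> uS vS'; rewrite cabsM mulr_ile1 ?cabs_ge0 ?cabs_res_le1. Qed.

Lemma cabs_res_gt0 S u : 0 < cabs (res S u).
Proof.
rewrite cabs_gt0 !mulf_neq0 ?invr_eq0 ?phi_neq0 // eq_complex /= eqxx /=.
by rewrite gt_eqF.
Qed.

Lemma res_comm S u v : u != v -> u \in S -> v \in S ->
  res S u * res (S `\ u) v = res S v * res (S `\ v) u.
Proof.
move=> uv uS vS; rewrite /res (fsetDAC1 _ v u); field.
by rewrite !phi_neq0.
Qed.

Lemma cabs_ieta : cabs (0 +i* eta) = eta.
Proof. by rewrite /cabs /= expr0n add0r sqrtr_sqr gtr0_norm. Qed.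

(** A path from [v] in S - u is the tail of a path from [u] with first step [v], so the Ward sum of
    [v] is part of that of [u], which is at most |phi(S)| |phi(S - u)| / eta. If [u] keeps an atom
    as eta -> 0, its neighbour [v] therefore has none in S - u. *)
Lemma Re_res_neighbour S u v : e u v -> u \in S -> v \in S `\ u ->
  Re (res (S `\ u) v) * cabs (res S u) <= eta ^+ 2.
Proof.
move=> uv uS vSu; rewrite Re_resE // /res !cabsM cabsV -cabs_sqr.
have hp := phi_neq0; have h1 : 0 < cabs (phi S) by rewrite cabs_gt0.
have h2 : 0 < cabs (phi (S `\ u)) by rewrite cabs_gt0.
rewrite cabs_ieta.
have le1 : psum (S `\ u `\ v) v [:: u] (fun S' _ => cabs2 (phi S')) <=
           psum (S `\ u) u [::] (fun S' _ => cabs2 (phi S')).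
  rewrite [leRHS]psumE (nsumD1 e _ _ vSu) uv -[leLHS]add0r lerD //.
    by rewrite -cabs_sqr sqr_ge0.
  rewrite lerDl; apply: sumr_ge0 => w _; apply: sumr_ge0 => P _.
  by rewrite -cabs_sqr sqr_ge0.
have le2 : eta * psum (S `\ u) u [::] (fun S' _ => cabs2 (phi S')) <=
  cabs (phi S) * cabs (phi (S `\ u)).
  rewrite Ward ?fsetD11 // fsetD1K // -cabsM.
  rewrite (_ : im2 _ _ = Im (phi S * conjc (phi (S `\ u)))).
    rewrite (le_trans (Im_le_cabs _)) // !cabsM ler_wpM2l ?cabs_ge0 //.
    by case: (phi (S `\ u)) => a b; rewrite /cabs /= sqrrN.
  by case: (phi S) (phi (S `\ u)) => a b [c d]; rewrite /im2 /=; ring.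
rewrite (psum_head e _ _ _ [:: u]).
rewrite (_ : _ * _ = eta ^+ 2 * ((eta * psum (S `\ u `\ v) v [:: u]
   (fun S' _ => cabs2 (phi S'))) / (cabs (phi S) * cabs (phi (S `\ u))))).
  rewrite -[leRHS]mulr1 ler_wpM2l ?sqr_ge0 // ler_pdivrMr ?mulr_gt0 // mul1r.
  by rewrite (le_trans _ le2) // ler_wpM2l // ltW.
by field; rewrite !gt_eqF.
Qed.

Section NonnegSums.
Variable F : {fset T} -> R.
Hypothesis F_ge0 : forall S, 0 <= F S.

Lemma psum_to_ge0 S u v : 0 <= psum_to S u v F.
Proof. by apply: sumr_ge0 => P _; case: ifP. Qed.

Lemma psum_to_sum_le S u (s : seq T) : uniq s ->
  \sum_(v <- s) psum_to S u v F <= psum S u [::] (fun S' _ => F S').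
Proof.
move=> us; rewrite /psum_to /psum exchange_big; apply: ler_sum => P _.
case: P => S' [|x p] /=; first by rewrite big1 // => v _; rewrite /ends.
rewrite /ends /=; have [xs|xs] := boolP (x \in s).
  rewrite (bigD1_seq x) //= eqxx big1 ?addr0 // => v vx.
  by case: eqP => // -[xv]; rewrite xv eqxx in vx.
rewrite big_seq big1 // => v vs; case: eqP => // -[xv].
by rewrite xv vs in xs.
Qed.

Lemma psum_to_le S u v : psum_to S u v F <= psum S u [::] (fun S' _ => F S').
Proof. by have := @psum_to_sum_le S u [:: v]; rewrite big_seq1; apply. Qed.

Lemma psum_to_subset S u v x : x \in S ->
  psum_to (S `\ x) u v (fun S' => F (x |` S')) <= psum_to S u v F.
Proof.
elim/fproper_ind: S u => S IH u xS.
rewrite psum_to_rec [leRHS]psum_to_rec fsetD1K // lerD2l (nsumD1 e _ _ xS).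
rewrite -[leLHS]add0r lerD //; first by case: ifP => // _; apply: psum_to_ge0.
rewrite /nsum big_seq_cond [leRHS]big_seq_cond; apply: ler_sum => w.
rewrite !inE => /andP[/andP[wx wS] _]; rewrite fsetDAC1 IH ?fproperD1 //.
by rewrite !inE eq_sym wx.
Qed.
End NonnegSums.

Lemma fset1UD1 S u x : x != u -> (x |` S) `\ u = x |` (S `\ u).
Proof.
move=> xu; apply/fsetP => w; rewrite !inE; case: (eqVneq w x) => [->|] //=.
by rewrite xu.
Qed.

Lemma Heilmann_Lieb_phi S u v : u \in S -> v \in S -> u != v ->
  psum_to (S `\ u) u v (fun S' => phi S' ^+ 2) =
  phi (S `\ u) * phi (S `\ v) - phi S * phi (S `\ u `\ v).
Proof.
move=> uS vS uv.
have aE S' w : S' `<=` S -> w \in S' -> phi S' = z * phi (S' `\ w)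
    - nsum e (S' `\ w) w (fun y => phi (S' `\ w `\ y)).
  by move=> _; apply: phiE.
have bE S' w : S' `<=` S -> w \in S' -> phi S' = z * phi (S' `\ w)
    - 0 * phi (S' `\ w) - nsum e (S' `\ w) w (fun y => phi (S' `\ w `\ y)).
  by move=> _; rewrite mul0r subr0; apply: phiE.
have H := Heilmann_Lieb (c := fun=> 0) aE bE (fsubset_refl _) uS vS uv.
set X := psum_to _ _ _ _; set Y := _ - _.
have /eqP : (X - Y) *+ 2 = 0 by rewrite mulrnBl [X *+ 2]H /Y; ring.
by rewrite mulrn_eq0 /= subr_eq0 => /eqP.
Qed.

Lemma Heilmann_Lieb_derivative S u v x :
  u \in S -> v \in S -> x \in S -> u != v -> u != x -> v != x ->
  psum_to (S `\ x `\ u) u v (fun S' => phi S' * phi (x |` S')) *+ 2 =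
  phi (S `\ x `\ u) * phi (S `\ v) + phi (S `\ u) * phi (S `\ x `\ v)
  - phi (S `\ x) * phi (S `\ u `\ v) - phi S * phi (S `\ x `\ u `\ v).
Proof.
move=> uS vS xS uv ux vx.
(* Expanded at [w], phi(S' + x) has one more term than the recurrence over S', phi(S' - w) for the
   edge from [w] to [x]; this is the inhomogeneous term of [b]. *)
pose c w : R[i] := if e w x then 1 else 0.
rewrite (@Heilmann_Lieb _ _ _ z c (S `\ x) phi (fun S' => phi (x |` S'))) //.
- rewrite fsetD1K // (fsetDAC1 _ x v) (fsetDAC1 _ x u) (fsetDAC1 _ x v).
  by rewrite !fsetD1K ?inE // ?[x == _]eq_sym ?vx ?ux ?xS.
- by move=> S' w _ wS'; apply: phiE.
- move=> S' w sS' wS'; have wx : w != x by have := fsubsetP sS' w wS'; rewrite !inE => /andP[].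
  rewrite (@phiE _ _ _ z e_sym (x |` S') w) ?fset1Ur // fset1UD1 1?eq_sym //.
  have xS' : x \notin S'.
    by apply/negP => /(fsubsetP sS'); rewrite !inE eqxx.
  rewrite (@nsumD1 _ _ _ (x |` S' `\ w) w x) ?fset1U1 // fsetU1K; last first.
    by rewrite !inE negb_and xS' orbT.
  rewrite /c opprD addrA; congr (_ - _ - _).
    by case: ifP => _; rewrite ?mul1r ?mul0r // fsetU1K // !inE negb_and xS' orbT.
  apply: eq_nsum => y; rewrite !inE => /andP[yw yS] _.
  by rewrite fset1UD1 //; apply: contraNneq xS' => ->.
- by rewrite !inE ux.
- by rewrite !inE vx.
Qed.

Lemma cabs_psum_to S u v (F : {fset T} -> R[i]) :
  cabs (psum_to S u v F) <= psum_to S u v (fun S' => cabs (F S')).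
Proof.
rewrite (le_trans (cabs_sum _ _ _)) //; apply: ler_sum => P _.
by case: ifP => // _; rewrite cabs0.
Qed.

(** By Heilmann--Lieb, replacing res(S, v) by res(S - u, v) in the product changes it by a sum of
    phi(S')^2 over the paths from [u] to [v]. In modulus this is at most a piece of the Ward sum of
    [u]. *)
Lemma res_pair_le S u v : u \in S -> v \in S -> u != v ->
  cabs (res S u) * cabs (res S v) <= cabs (res S u) * cabs (res (S `\ u) v) +
   eta ^+ 2 * psum_to (S `\ u) u v (fun S' => cabs2 (phi S')) / cabs2 (phi S).
Proof.
move=> uS vS uv; have hp := phi_neq0.
rewrite -!cabsM (_ : res S u * res S v = res S u * res (S `\ u) v +
  (0 +i* eta) ^+ 2 * psum_to (S `\ u) u v (fun S' => phi S' ^+ 2) / phi S ^+ 2).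
  rewrite (le_trans (cabsD _ _)) // lerD2l !(cabsX, cabsM, cabsV) cabs_ieta -?expr2 cabs_sqr.
  rewrite ler_wpM2r ?invr_ge0 -?cabs_sqr ?sqr_ge0 // ler_wpM2l ?sqr_ge0 //.
  rewrite (le_trans (cabs_psum_to _ _ _ _)) //; apply: ler_sum => P _.
  by case: ifP => _; rewrite ?cabs0 // cabsX cabs_sqr.
by rewrite Heilmann_Lieb_phi // /res; field; rewrite !hp.
Qed.

(** For distinct [v] the path sums of [res_pair_le] use disjoint sets of paths, so together they are
    at most the Ward sum [Re (res S u)]. Dividing by the modulus of [res S u] leaves the constant 1,
    whatever the length of [s]. *)
Lemma res_sum_le S u (s : seq T) : u \in S -> uniq s -> {subset s <= S `\ u} ->
  \sum_(v <- s) cabs (res S v) <= 1 + \sum_(v <- s) cabs (res (S `\ u) v).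
Proof.
move=> uS us sS; rewrite -(@ler_pM2l _ (cabs (res S u))) ?cabs_res_gt0 //.
rewrite mulrDr mulr1 !mulr_sumr.
apply: (@le_trans _ _ (\sum_(v <- s) (cabs (res S u) * cabs (res (S `\ u) v) +
   eta ^+ 2 * psum_to (S `\ u) u v (fun S' => cabs2 (phi S')) / cabs2 (phi S)))).
  rewrite big_seq [leRHS]big_seq; apply: ler_sum => v /sS.
  by rewrite !inE => /andP[vu vS]; apply: res_pair_le => //; rewrite eq_sym.
rewrite big_split /= addrC lerD2r -mulr_suml -mulr_sumr.
rewrite (le_trans _ (Re_le_cabs _)) // Re_resE // ler_wpM2r ?invr_ge0 -?cabs_sqr ?sqr_ge0 //.
rewrite ler_wpM2l ?sqr_ge0 //; apply: psum_to_sum_le => // S'.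
by rewrite -cabs_sqr sqr_ge0.
Qed.

(* Quantitative transitivity.  Reversing the paths from [u] to [y] in [S `\ x]
   bounds their contribution by the Ward sum at [y], hence by [res (S `\ x) y]. *)
Lemma res_triple_le S u x y (t : R) : 0 < t ->
  u \in S -> x \in S -> y \in S -> u != x -> u != y -> x != y ->
  cabs (res S u) * cabs (res S y) * cabs (res (S `\ u) x) <=
  cabs (res (S `\ y) x) + 2 * cabs (res (S `\ u) y) + (t
  + Re (res (S `\ x) y) / t).
Proof.
move=> t0 uS xS yS ux uy xy.
have hp := phi_neq0; have yx : y != x by rewrite eq_sym.
have xSu : x \in S `\ u by rewrite !inE eq_sym ux.
have ySu : y \in S `\ u by rewrite !inE eq_sym uy.
have xSy : x \in S `\ y by rewrite !inE xy.
have ySx : y \in S `\ x by rewrite !inE yx.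
have uSx : u \in S `\ x by rewrite !inE ux.
have xSuy : x \in S `\ u `\ y by rewrite !inE xy eq_sym ux.
set k : R[i] := 0 +i* eta.
have D := Heilmann_Lieb_derivative uS yS xS uy ux yx.
set X := psum_to _ _ _ _ in D.
(* Multiplied by k^3 / phi(S)^2, the four products in [D] become triple products of resolvents;
   three of them contain a factor that is small in the application. *)
have E : res S u * res S y * res (S `\ u) x =
   - (res S u * res S y * res (S `\ y) x) + (res S x * res S u * res (S `\ u) y
   + res S u * res (S `\ u) y * res (S `\ u `\ y) x) + k ^+ 3 * (X *+ 2) / phi S ^+ 2.
  rewrite D /res -/k (fsetDAC1 S y x) (fsetDAC1 S x u) (fsetDAC1 (S `\ u) y x).
  by field; rewrite !hp.
rewrite -!cabsM E (le_trans (cabsD _ _)) // lerD //.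
  rewrite (le_trans (cabsD _ _)) // lerD //.
    rewrite cabsN cabsM -[leRHS]mul1r ler_wpM2r ?cabs_ge0 //.
    exact: cabs_resM_le1.
  rewrite (le_trans (cabsD _ _)) // mulr_natl mulr2n lerD //.
    rewrite cabsM -[leRHS]mul1r ler_wpM2r ?cabs_ge0 //.
    exact: cabs_resM_le1.
  rewrite mulrAC cabsM -[leRHS]mul1r ler_wpM2r ?cabs_ge0 //.
  exact: cabs_resM_le1.
set p := cabs (phi S); set m := cabs (phi (S `\ x)).
have p0 : 0 < p by rewrite cabs_gt0.
have m0 : 0 < m by rewrite cabs_gt0.
(* This is |res(S, x)|; it reconciles the denominator p^2 of the path sum with the product p m
   wanted for its two factors. *)
have rx : eta * m / p <= 1.
  by have := cabs_res_le1 xS; rewrite /res !cabsM cabsV cabs_ieta.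
set A := psum_to (S `\ x `\ u) u y (fun S' => cabs2 (phi (x |` S'))).
set B := psum_to (S `\ x `\ u) u y (fun S' => cabs2 (phi S')).
have leA : t * (eta ^+ 2 * A / p ^+ 2) <= t.
  rewrite -[leRHS]mulr1 ler_wpM2l ?(ltW t0) //.
  rewrite (le_trans _ (cabs_res_le1 uS)) // (le_trans _ (Re_le_cabs _)) // Re_resE //.
  rewrite cabs_sqr ler_wpM2r ?invr_ge0 -?cabs_sqr ?sqr_ge0 // ler_wpM2l ?sqr_ge0 //.
  have c0 S' : 0 <= cabs2 (phi S') by rewrite -cabs_sqr sqr_ge0.
  rewrite (le_trans _ (psum_to_le c0 _ _ y)) // /A fsetDAC1.
  exact: (@psum_to_subset (fun S' => cabs2 (phi S'))).
have leB : (eta ^+ 2 * B / m ^+ 2) / t <= Re (res (S `\ x) y) / t.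
  rewrite ler_wpM2r ?invr_ge0 ?(ltW t0) // Re_resE //.
  rewrite cabs_sqr ler_wpM2r ?invr_ge0 -?cabs_sqr ?sqr_ge0 // ler_wpM2l ?sqr_ge0 //.
  rewrite /B (psum_to_rev e_sym) //; apply: psum_to_le => S'.
  by rewrite -cabs_sqr sqr_ge0.
apply: le_trans (lerD leA leB).
have leX : cabs X <= psum_to (S `\ x `\ u) u y
   (fun S' => cabs (phi S') * cabs (phi (x |` S'))).
  by rewrite (le_trans (cabs_psum_to _ _ _ _)) //; apply: ler_sum => P _; case: ifP; rewrite ?cabsM.
have -> : cabs (k ^+ 3 * (X *+ 2) / phi S ^+ 2) = eta ^+ 3 * 2 / p ^+ 2 * cabs X.
  rewrite !(cabsX, cabsM, cabsV, cabsMn) cabs_ieta.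
  by field; rewrite gt_eqF.
apply: (@le_trans _ _ (eta ^+ 3 * 2 / p ^+ 2 * psum_to (S `\ x `\ u) u y
   (fun S' => cabs (phi S') * cabs (phi (x |` S'))))).
  by rewrite ler_wpM2l // divr_ge0 ?mulr_ge0 ?exprn_ge0 ?ltW.
rewrite /A /B /psum_to /psum !(mulr_sumr, mulr_suml) -big_split /=.
apply: ler_sum => P _; case: ifP => _; last by rewrite !(mulr0, mul0r) addr0.
rewrite -!cabs_sqr; set b := cabs (phi P.1); set a := cabs (phi _).
have a0 : 0 <= a := cabs_ge0 _; have b0 : 0 <= b := cabs_ge0 _.
(* Path by path this is the weighted inequality 2 c d <= t c^2 + d^2 / t. *)
pose c := eta * a / p; pose d := eta * b / m.
have c0 : 0 <= c by rewrite divr_ge0 ?mulr_ge0 // ltW.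
have d0 : 0 <= d by rewrite divr_ge0 ?mulr_ge0 // ltW.
have -> : eta ^+ 3 * 2 / p ^+ 2 * (b * a) = (eta * m / p) * (2 * c * d).
  by rewrite /c /d; field; rewrite !gt_eqF.
have -> : t * (eta ^+ 2 * a ^+ 2 / p ^+ 2) + eta ^+ 2 * b ^+ 2 / m ^+ 2 / t =
   t * c ^+ 2 + d ^+ 2 / t.
  by rewrite /c /d; field; rewrite !gt_eqF.
apply: (@le_trans _ _ (2 * c * d)).
  apply: ler_piMl rx.
  by apply: mulr_ge0 => //; apply: mulr_ge0.
rewrite -subr_ge0 (_ : _ - _ = (t * c - d) ^+ 2 / t) ?divr_ge0 ?sqr_ge0 ?ltW //.
by field; rewrite gt_eqF.
Qed.

(* Green's identity and Cauchy--Schwarz; applied to [f = q(A) delta_u]. *)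
Lemma res_lower_bound S u (f : seq T -> R) : u \in S ->
  eta ^+ 2 * f [:: u] ^+ 2 <= Re (res S u) *
  psum (S `\ u) u [::] (fun S' p =>
    (theta * f p - tree_adj e u S' p f) ^+ 2 + eta ^+ 2 * f p ^+ 2).
Proof.
move=> uS; set Q := psum _ _ _ _.
pose fC p : R[i] := (f p)%:C.
have := @tree_Green _ e _ u e_sym z (S `\ u) u [::] fC (negbT (fsetD11 _ _)).
rewrite fsetD1K // /par /= mulr0 subr0 => G.
have adjC S' p : tree_adj e u S' p fC = (tree_adj e u S' p f)%:C.
  rewrite /tree_adj /nsum rmorphD rmorph_sum; congr (_ + _).
  by rewrite /par; case: ifP.
have p0 : 0 < cabs2 (phi S) by rewrite -cabs_sqr exprn_gt0 // cabs_gt0 phi_neq0.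
rewrite Re_resE //; set W := psum _ _ _ _.
have -> : eta ^+ 2 * W / cabs2 (phi S) * Q = eta ^+ 2 * (W * Q / cabs2 (phi S)).
  by field; rewrite gt_eqF.
rewrite ler_wpM2l ?sqr_ge0 // ler_pdivlMr // mulrC.
have -> : cabs2 (phi S) * f [:: u] ^+ 2 = cabs (phi S * fC [:: u]) ^+ 2.
  by rewrite cabsM exprMn !cabs_sqr /cabs2 /= expr0n addr0.
rewrite -G.
apply: (@le_trans _ _ (psum (S `\ u) u [::] (fun S' p => cabs (phi S') *
    cabs (z * fC p - tree_adj e u S' p fC)) ^+ 2)).
  rewrite ler_sqr ?nnegrE ?cabs_ge0 //; last first.
    by apply: sumr_ge0 => P _; rewrite mulr_ge0 ?cabs_ge0.
  rewrite (le_trans (cabs_sum _ _ _)) //; apply: ler_sum => P _.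
  by rewrite cabsM.
rewrite (le_trans (Cauchy_Schwarz_seq _ _ _)) //.
rewrite (_ : \sum_(P <- _) cabs (phi P.1) ^+ 2 =
   psum (S `\ u) u [::] (fun S' _ => cabs2 (phi S'))); last first.
  by apply: eq_bigr => P _; rewrite cabs_sqr.
rewrite -/W ler_wpM2l //.
  by apply: sumr_ge0 => P _; rewrite -cabs_sqr sqr_ge0.
rewrite /Q; apply: ler_sum => P _; rewrite cabs_sqr adjC /cabs2 /=.
by rewrite le_eqVlt; apply/orP; left; apply/eqP; ring.
Qed.

End Resolvent.

(** * Moments of the path tree *)

Section FormalMoments.
Variable R : comNzRingType.
Implicit Types (m : nat -> R) (q : {poly R}).

Definition lmom m q : R := \sum_(i < size q) q`_i * m i.

Lemma lmomE m q n : (size q <= n)%N -> lmom m q = \sum_(i < n) q`_i * m i.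
Proof.
move=> le; rewrite /lmom (big_ord_widen _ (fun i => q`_i * m i) le) big_mkcond /=.
apply: eq_bigr => i _; case: ltnP => // h; by rewrite nth_default // mul0r.
Qed.

Lemma lmomD m q q' : lmom m (q + q') = lmom m q + lmom m q'.
Proof.
set n := maxn (size q) (size q').
rewrite (@lmomE _ _ n) ?size_polyD // (@lmomE _ q n) ?leq_maxl //.
rewrite (@lmomE _ q' n) ?leq_maxr // -big_split /=.
by apply: eq_bigr => i _; rewrite coefD mulrDl.
Qed.

Lemma lmomDl m m' q : lmom (fun i => m i + m' i) q = lmom m q + lmom m' q.
Proof. by rewrite /lmom -big_split; apply: eq_bigr => i _; rewrite mulrDr. Qed.

Lemma lmomZ m c q : lmom m (c *: q) = c * lmom m q.
Proof.
rewrite (@lmomE _ _ (size q)) ?size_scale_leq // /lmom mulr_sumr.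
by apply: eq_bigr => i _; rewrite coefZ mulrA.
Qed.

Lemma lmom0 m : lmom m 0 = 0.
Proof. by rewrite /lmom size_poly0 big_ord0. Qed.

Lemma lmomN m q : lmom m (- q) = - lmom m q.
Proof. by rewrite -scaleN1r lmomZ mulN1r. Qed.

Lemma lmomX m q : lmom m ('X * q) = lmom (fun i => m i.+1) q.
Proof.
rewrite (@lmomE _ _ (size q).+1); last first.
  by rewrite (leq_trans (size_polyMleq _ _)) // size_polyX.
rewrite big_ord_recl coefXM eqxx mul0r add0r /lmom.
by apply: eq_bigr => i _; rewrite coefXM.
Qed.

Lemma lmomXn m q n : lmom m ('X^n * q) = lmom (fun i => m (n + i)%N) q.
Proof.
elim: n m => [|n IH] m; first by rewrite expr0 mul1r.
by rewrite exprS -mulrA lmomX IH.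
Qed.

Lemma lmomM m q q' : lmom m (q * q') = lmom (fun i => lmom (fun j => m (i + j)%N) q') q.
Proof.
rewrite -{1}(coefK q) poly_def mulr_suml.
rewrite (big_morph _ (lmomD m) (lmom0 m)); apply: eq_bigr => i _.
by rewrite -scalerAl lmomZ lmomXn.
Qed.

Lemma eq_lmom m m' q : (forall i, (i < size q)%N -> m i = m' i) ->
  lmom m q = lmom m' q.
Proof. by move=> h; apply: eq_bigr => i _; rewrite h. Qed.

Lemma lmom_suml I (s : seq I) (P : pred I) (c : I -> R) (m : I -> nat -> R) q :
  \sum_(i <- s | P i) c i * lmom (m i) q =
  lmom (fun k => \sum_(i <- s | P i) c i * m i k) q.
Proof.
rewrite /lmom; under eq_bigr do rewrite mulr_sumr.
rewrite exchange_big; apply: eq_bigr => k _; rewrite mulr_sumr.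
by apply: eq_bigr => i _; rewrite mulrCA.
Qed.

End FormalMoments.

(** * Local finiteness of the path tree *)

Section ValidPaths.
Variables (G : graph) (D : nat).
Hypothesis degG : max_deg_le D G 0.

Lemma adjC : symmetric (adj G).
Proof. by move=> x y; rewrite /adj eq_sym orbC. Qed.

Lemma comp_adj a u x : comp G a u -> adj G u x -> comp G a x.
Proof.
move=> [s [ps <-]] ux; exists (rcons s x).
by rewrite rcons_path ps ux last_rcons.
Qed.

Lemma comp_path a u s : comp G a u -> path (adj G) u s -> comp G a (last u s).
Proof.
elim: s u => //= x s IH u cu /andP[ux ps]; apply: IH ps; exact: comp_adj ux.
Qed.

(* Vertices of the path tree: paths ending at the root [u], listed backwards. *)
Definition vpath u (p : seq nat) : bool :=
  if p is h :: t then path (adj G) h t && (last h t == u) else false.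

Lemma vpath_comp u p : comp G 0 u -> vpath u p -> comp G 0 (head u p).
Proof.
case: p => //= h t cu /andP[pt /eqP lt].
have : path (adj G) u (rev (belast h t)).
  by rewrite -lt rev_path (eq_path (e' := adj G)) // => x y; rewrite adjC.
move=> /(comp_path cu); case: t lt {pt} => [/= <- //|x t] lt.
by rewrite /= rev_cons last_rcons.
Qed.

Lemma vpath_cons u x p : vpath u p -> adj G (head u p) x -> vpath u (x :: p).
Proof. by case: p => //= h t /andP[-> ->]; rewrite adjC => ->. Qed.

Lemma vpath_behead u p : (1 < size p)%N -> vpath u p -> vpath u (behead p).
Proof. by case: p => //= h [|x t] //= _ /andP[/andP[_ ->] ->]. Qed.

Lemma nbr_bounded u : comp G 0 u -> exists b, forall x, adj G u x -> (x < b)%N.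
Proof.
move=> cu; apply: contrapT => /forallNP unb.
have step b : exists2 x, adj G u x & (b <= x)%N.
  have /existsNP[x /not_implyP[ux /negP]] := unb b.
  by rewrite -leqNgt => bx; exists x.
have [s [us [as_ ss]]] : exists s, [/\ uniq s, all (adj G u) s & size s = D.+1].
  elim: D.+1 => [|k [s [us as_ ss]]]; first by exists [::].
  have [x ux bx] := step (\max_(y <- s) y.+1)%N.
  exists (x :: s); split; rewrite /= ?us ?ux ?as_ ?ss // andbT.
  apply/negP => xs; have : (x < \max_(y <- s) y.+1)%N.
    by rewrite (big_rem x) //= leq_maxl.
  by rewrite ltnNge bx.
by have := degG cu us as_; rewrite ss ltnn.
Qed.

Lemma vpath_bounded u m : comp G 0 u ->
  exists n0, forall p, vpath u p -> (size p <= m.+1)%N -> (head u p < n0)%N.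
Proof.
move=> cu; elim: m => [|m [n0 IH]].
  by exists u.+1 => -[//|h [|x t]] /=; [move=> /eqP -> | move=> _].
have [b hb] : exists b : nat -> nat, forall y, comp G 0 y -> forall x, adj G y x -> (x < b y)%N.
  have /choice[b hb] : forall y, exists b, comp G 0 y -> forall x, adj G y x -> (x < b)%N.
    move=> y; have [cy|ncy] := pselect (comp G 0 y); last by exists 0%N.
    by have [b hb] := nbr_bounded cy; exists b.
  by exists b.
exists (maxn n0 (\max_(y < n0) b y))%N => -[//|h [|x t]] vp sp.
  by rewrite (leq_trans (IH _ vp _)) ?leq_maxl.
have vx : vpath u (x :: t) by apply: (@vpath_behead u (h :: x :: t)).
have xn : (x < n0)%N := IH _ vx sp.
rewrite (leq_trans _ (leq_maxr _ _)) //= (leq_trans _ (leq_bigmax (Ordinal xn))) //=.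
apply: hb; first exact: (vpath_comp cu vx).
by move: vp => /= /andP[/andP[hx _] _]; rewrite adjC.
Qed.

End ValidPaths.

(** * Walk counts and their agreement with finite truncations *)

Section TreeWalks.
Variables (R : realType) (G : graph) (D : nat).
Hypothesis degG : max_deg_le D G 0.

Lemma tree_walks_ge0 u k p : (0 <= tree_walks R G u k p)%E.
Proof.
elim: k p => [|k IH] p /=; first by case: ifP.
rewrite adde_ge0 //; first by case: ifP.
by apply: nneseries_ge0 => x _ _; case: ifP.
Qed.

Lemma tree_walks_long u k p : (k.+1 < size p)%N -> tree_walks R G u k p = 0%E.
Proof.
elim: k p => [|k IH] p lt /=.
  by case: eqP lt => // ->.
rewrite (ltn_trans _ lt) // IH; last by rewrite size_behead ltn_predRL.
rewrite add0e.
apply: eseries0 => x _ _; case: ifP => // _; apply: IH.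
by rewrite /= ltnS ltnW // ltnW.
Qed.

Lemma nbr_series_le h (Q : pred nat) (f : nat -> \bar R) (c : R) :
  comp G 0 h -> 0 <= c -> (forall x, adj G h x -> (0 <= f x <= c%:E)%E) ->
  (\sum_(x <oo) (if adj G h x && Q x then f x else 0) <= (D%:R * c)%:E)%E.
Proof.
move=> ch c0 hf; apply: lime_le.
  by apply: is_cvg_nneseries => x _ _; case: ifP => // /andP[/hf/andP[]].
near=> n; rewrite -big_mkcond /=.
apply: (@le_trans _ _ (\sum_(0 <= x < n | adj G h x) c%:E)%E).
  rewrite big_mkcondr; apply: lee_sum => x /hf/andP[f0 fc].
  by case: ifP => // _; rewrite lee_fin.
rewrite sumEFin lee_fin big_const_seq iter_addr_0 -[_ *+ count _ _]mulr_natl ler_wpM2r //.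
rewrite ler_nat -size_filter; apply: (degG ch) (filter_all _ _).
by apply: filter_uniq; apply: iota_uniq.
Unshelve. all: end_near. Qed.

Variable u : nat.
Hypothesis cu : comp G 0 u.

(** A path has one parent and at most [D] children, so each step multiplies by at most [D.+1]. This
    rate later confines the support of the matching measure. *)
Lemma tree_walks_le k p : vpath G u p ->
  (tree_walks R G u k p <= (D.+1%:R ^+ k)%:E)%E.
Proof.
elim: k p => [|k IH] p vp /=; first by case: ifP; rewrite lee_fin.
have -> : D.+1%:R ^+ k.+1 = D.+1%:R ^+ k + D%:R * D.+1%:R ^+ k :> R.
  by rewrite exprS -(natr1 D); ring.
rewrite EFinD; apply: leeD.
  by case: ifP => [sp|_]; rewrite ?IH ?vpath_behead // lee_fin exprn_ge0.
apply: nbr_series_le => [||x hx]; first exact: vpath_comp cu vp.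
  by rewrite exprn_ge0.
by rewrite tree_walks_ge0 IH // vpath_cons.
Qed.

Lemma tree_walks_fin k p : vpath G u p -> tree_walks R G u k p \is a fin_num.
Proof.
move=> vp; rewrite ge0_fin_numE ?tree_walks_ge0 //.
by rewrite (le_lt_trans (tree_walks_le _ vp)) // ltry.
Qed.

Definition tw k p : R := fine (tree_walks R G u k p).

Lemma twE k p : vpath G u p -> (tw k p)%:E = tree_walks R G u k p.
Proof. by move=> vp; rewrite fineK ?tree_walks_fin. Qed.

Lemma tw0 p : tw 0 p = (p == [:: u])%:R.
Proof. by rewrite /tw /=; case: ifP. Qed.

Definition Sn n : {fset nat} := [fset x in iota 0 n].

Lemma in_Sn n x : (x \in Sn n) = (x < n)%N.
Proof. by rewrite !inE mem_iota. Qed.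

(* The nodes of the path tree of [G] restricted to [S0]. *)
Definition node (S0 : {fset nat}) (S : {fset nat}) (p : seq nat) :=
  vpath G u p /\ forall x, (x \in S) = (x \in S0) && (x \notin p).

Lemma node_root S0 : node S0 (S0 `\ u) [:: u].
Proof. by split=> [/=|x]; rewrite ?eqxx // !inE andbC. Qed.

Lemma node_step S0 S h t w : node S0 S (h :: t) -> w \in S -> adj G h w ->
  node S0 (S `\ w) (w :: h :: t).
Proof.
move=> [vp hS] wS hw; split; first by apply: vpath_cons.
by move=> x; rewrite in_fsetD1 hS [in RHS]in_cons negb_or andbCA.
Qed.

Lemma eq_psum_node (V : nmodType) S0 S q (F F' : {fset nat} -> seq nat -> V) h :
  node S0 S (h :: q) -> (forall S' p, node S0 S' p -> F S' p = F' S' p) ->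
  psum (adj G) S h q F = psum (adj G) S h q F'.
Proof.
move=> + FF'; elim/fproper_ind: S h q => S IH h q nd; rewrite psumE [RHS]psumE FF' //.
congr (_ + _); apply: eq_nsum => w wS hw; apply: IH; first exact: fproperD1.
exact: node_step.
Qed.

(** [tw k] vanishes on paths of more than [k.+1] vertices, and by local finiteness the shorter ones
    stay below some [n0]. Truncation thus loses no nonzero term: in the finite tree too, [tw k] is
    A^k applied to the root vector. *)
Lemma tree_adj_tw m : exists n0, forall n, (n0 <= n)%N -> forall S p k,
  node (Sn n) S p -> (k <= m)%N -> tree_adj (adj G) u S p (tw k) = tw k.+1 p.
Proof.
have [n0 hn0] := vpath_bounded degG m.+1 cu.
exists n0 => n len S p k [vp hS] km.
apply: EFin_inj; rewrite twE //= /tree_adj EFinD /par; congr (_ + _)%E.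
  by case: ifP => // sp; rewrite twE // vpath_behead.
pose g x := if adj G (head u p) x && (x \notin p) then tree_walks R G u k (x :: p) else 0%E.
have g0 x : (n <= x)%N -> g x = 0%E.
  move=> nx; rewrite /g; case: ifP => // /andP[px xp].
  apply: tree_walks_long; rewrite ltnNge /=; apply/negP => sp.
  have le : (size (x :: p) <= m.+2)%N by rewrite /= (leq_trans sp) // ltnS ltnW.
  by have := hn0 _ (vpath_cons vp px) le; rewrite /= ltnNge (leq_trans len).
rewrite -[RHS]/(\sum_(x <oo) g x)%E (nneseries_split 0 n); last first.
  by move=> x _; rewrite /g; case: ifP => // _; apply: tree_walks_ge0.
rewrite add0n eseries0 ?adde0; last by move=> x nx _; apply: g0.
rewrite /nsum /g -big_mkcond /= -sumEFin.
have pe : perm_eq (enum_fset S) [seq x <- index_iota 0 n | x \notin p].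
  apply: uniq_perm; rewrite ?fset_uniq ?filter_uniq ?iota_uniq // => x.
  by rewrite mem_filter mem_index_iota -[LHS]/(x \in S) hS in_Sn andbC.
rewrite (perm_big _ pe) /= big_filter_cond; apply: eq_big => x; first exact: andbC.
by move=> /andP[_ px]; rewrite twE // vpath_cons.
Qed.

End TreeWalks.

Lemma psum_size_eq0 (T : choiceType) (e : rel T) (V : nmodType) S w q
    (F : {fset T} -> seq T -> V) :
  (forall S' p, (1 < size p)%N -> F S' p = 0) -> (0 < size q)%N ->
  psum e S w q F = 0.
Proof.
move=> F0; elim/fproper_ind: S w q => S IH w q q0; rewrite psumE F0 // add0r.
by rewrite /nsum big_seq_cond big1 // => x /andP[xS _]; rewrite IH // fproperD1.
Qed.

Section MomentBound.
Variables (R : realType) (G : graph) (D : nat).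
Hypothesis degG : max_deg_le D G 0.
Variable u : nat.
Hypothesis cu : comp G 0 u.
Local Notation tw := (tw R G u).
Local Notation e := (adj G).
Local Notation M := (fun k => tw k [:: u]).

Definition twq (q : {poly R}) p := lmom (fun k => tw k p) q.

Lemma tree_adj_lmom S p (f : nat -> seq nat -> R) q :
  tree_adj e u S p (fun p' => lmom (f^~ p') q) =
  lmom (fun k => tree_adj e u S p (f k)) q.
Proof.
rewrite /tree_adj lmomDl; congr (_ + _).
  rewrite /par; case: ifP => // _.
  by rewrite /lmom big1 // => i _; rewrite mulr0.
rewrite /nsum /lmom exchange_big; apply: eq_bigr => i _.
by rewrite mulr_sumr.
Qed.

(** [res_lower_bound] for q(A) applied to the root vector; for large [n] the inner products are
    moments of [G] itself. [n0] depends on the size bound [m], not on [theta], [eta] or [q]. *)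
Lemma moment_bound m : exists n0, forall n, (n0 <= n)%N ->
  (u < n)%N /\
  forall (theta eta : R) (q : {poly R}), 0 < eta -> (size q <= m)%N ->
  eta ^+ 2 * lmom M q ^+ 2 <= Re (res e theta eta (Sn n) u) *
   (lmom M ((('X - theta%:P) * q) * (('X - theta%:P) * q)) + eta ^+ 2 * lmom M (q * q)).
Proof.
have [n0 hn0] := @tree_adj_tw R _ _ degG _ cu (m + m).+3.
exists (maxn n0 u.+1) => n; rewrite geq_max => /andP[n0n un].
split=> // theta eta q eta0 sq.
have uS : u \in Sn n by rewrite in_Sn.
have root := node_root G u (Sn n).
pose ps F := psum e (Sn n `\ u) u [::] (F : {fset nat} -> seq nat -> R).
(* Symmetry of the operator moves one power at a time to the other factor, until [tw 0], the
   indicator of the root, remains. *)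
have inner i j : (i + j <= (m + m).+3)%N -> ps (fun _ p => tw i p * tw j p) = tw (i + j) [:: u].
  elim: i j => [|i IH] j le.
    rewrite /ps psumE tw0 eqxx mul1r /nsum big1 ?addr0 // => w _.
    apply: psum_size_eq0 => // S' p sp; rewrite tw0.
    by case: eqP sp => [->|]; rewrite ?mul0r.
  rewrite addSnnS -IH ?addnS // /ps.
  have E : psum e (Sn n `\ u) u [::] (fun S p => tw j p * tree_adj e u S p (tw i)) =
           psum e (Sn n `\ u) u [::] (fun S p => tw i p * tree_adj e u S p (tw j)).
    have := tree_adj_sym e u (Sn n `\ u) u [::] (tw j) (tw i).
    by rewrite /par /= !mulr0 subrr /psum sumrB => /subr0_eq.
  transitivity (psum e (Sn n `\ u) u [::] (fun S p => tw j p * tree_adj e u S p (tw i))).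
    apply: (eq_psum_node root) => S p nd; rewrite mulrC (hn0 _ n0n _ _ _ nd) //.
    by rewrite (leq_trans _ le) // ltnW // leq_addr.
  rewrite [LHS]E; apply: (eq_psum_node root) => S p nd; rewrite (hn0 _ n0n _ _ _ nd) //.
  by rewrite (leq_trans _ le) // ltnW // ltnS leq_addl.
have innerq (a b : {poly R}) : (size a <= m.+1)%N -> (size b <= m.+1)%N ->
    ps (fun _ p => twq a p * twq b p) = lmom M (a * b).
  move=> sa sb; rewrite lmomM /ps /psum.
  under eq_bigr do rewrite mulrC.
  rewrite lmom_suml; apply: eq_lmom => i ia.
  under eq_bigr do rewrite mulrC.
  rewrite lmom_suml; apply: eq_lmom => j jb; apply: inner.
  apply: (@leq_trans (m.+1 + m.+1)%N); last by rewrite addSn addnS.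
  by apply: leq_add; apply: ltnW; [apply: leq_trans sa | apply: leq_trans sb].
pose w := 'X - theta%:P.
have swq : (size (w * q)%R <= m.+1)%N.
  by rewrite (leq_trans (size_polyMleq _ _)) // size_XsubC.
have adjq S p : node G u (Sn n) S p -> theta * twq q p - tree_adj e u S p (twq q) = - twq (w * q) p.
  move=> nd; rewrite [tree_adj _ _ _ _ _]tree_adj_lmom.
  rewrite (@eq_lmom _ _ (fun k => tw k.+1 p)); last first.
    move=> k kq; rewrite (hn0 _ n0n _ _ _ nd) // (leq_trans (ltnW kq)) // (leq_trans sq) //.
    by rewrite -!addnS leq_addr.
  by rewrite /twq /w mulrBl lmomD lmomN lmomX mul_polyC lmomZ; ring.
have := @res_lower_bound R _ e (adjC G) theta eta eta0 (Sn n) u (twq q) uS.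
rewrite {1}/twq => /le_trans; apply; rewrite le_eqVlt; apply/orP; left; apply/eqP.
congr (_ * _); rewrite -!innerq // ?(leq_trans sq) // /ps.
transitivity (psum e (Sn n `\ u) u [::] (fun _ p => twq (w * q) p * twq (w * q) p
    + eta ^+ 2 * (twq q p * twq q p))).
  by apply: (eq_psum_node root) => S p nd; rewrite adjq //; ring.
by rewrite /psum mulr_sumr -big_split.
Qed.

End MomentBound.

(** * Gallai's lemma for infinite graphs *)

Section Eventually.
Variable R : realType.
Implicit Type Q : R -> nat -> Prop.

(* The double limit n -> oo, then eta -> 0+. *)
Definition ev Q := exists2 eta0 : R, 0 < eta0 &
  forall eta, 0 < eta < eta0 -> exists n0, forall n, (n0 <= n)%N -> Q eta n.

Lemma ev_and Q Q' : ev Q -> ev Q' -> ev (fun eta n => Q eta n /\ Q' eta n).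
Proof.
move=> [a a0 ha] [b b0 hb]; exists (Num.min a b); first by rewrite lt_min a0.
move=> eta /andP[eta0]; rewrite lt_min => /andP[ea eb].
have [|n1 h1] := ha eta; first by rewrite eta0.
have [|n2 h2] := hb eta; first by rewrite eta0.
by exists (maxn n1 n2) => n; rewrite geq_max => /andP[/h1 ? /h2].
Qed.

Lemma ev_mono Q Q' : (forall eta n, 0 < eta -> Q eta n -> Q' eta n) -> ev Q -> ev Q'.
Proof.
move=> QQ' [a a0 ha]; exists a => // eta /[dup] /andP[eta0 _] /ha[n0 h].
by exists n0 => n /h; apply: QQ'.
Qed.

Lemma ev_all (T : eqType) (s : seq T) (Q : T -> R -> nat -> Prop) :
  (forall x, x \in s -> ev (Q x)) -> ev (fun eta n => forall x, x \in s -> Q x eta n).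
Proof.
elim: s => [|x s IH] h.
  by exists 1 => // eta _; exists 0%N.
have hx := h x (mem_head _ _).
have {}IH := IH (fun y ys => h y (mem_behead (s := x :: s) ys)).
apply: ev_mono (ev_and hx IH) => eta n _ [Qx Qs] y.
by rewrite inE => /predU1P[->|/Qs].
Qed.

Lemma ev_ex Q : ev Q -> exists eta n, 0 < eta /\ Q eta n.
Proof.
move=> [a a0 /(_ (a / 2))[|n0 h]]; first by rewrite divr_gt0 //= ltr_pdivrMr // ltr_pMr // ltr1n.
by exists (a / 2), n0; split; [rewrite divr_gt0|apply: h].
Qed.

Definition ev0 (f : R -> nat -> R) := forall eps, 0 < eps -> ev (fun eta n => f eta n <= eps).
End Eventually.

Section CriticalGraph.
Variables (R : realType) (theta : R) (G : graph).
Local Notation e := (adj G).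

Let r u (eta : R) n := res e theta eta (Sn n) u.
Let r2 u v (eta : R) n := res e theta eta (Sn n `\ u) v.

(* [p u] is a lower bound for the atom at [u] *)
Variable p : nat -> R.
Let atomic u := [/\ 0 < p u, p u <= 1 & forall eta, 0 < eta ->
  exists n0, forall n, (n0 <= n)%N -> (u < n)%N /\ p u <= Re (r u eta n)].

Let atomic_ev u : atomic u -> ev (fun eta n => u \in Sn n /\ p u <= cabs (r u eta n)).
Proof.
move=> [_ _ h]; exists 1 => // eta /andP[/h[n0 hn0] _].
exists n0 => n /hn0[un pn]; rewrite in_Sn; split=> //.
by rewrite (le_trans pn) // Re_le_cabs.
Qed.

Let irr u v : e u v -> u != v.
Proof. by case/andP. Qed.

Lemma ev0_adj u v : atomic u -> atomic v -> e u v ->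
  ev0 (fun eta n => cabs (r2 u v eta n)).
Proof.
move=> au av uv eps eps0; have [p0 p1 _] := au.
(* For x the modulus of [r2 u v], x^2 p_u <= eta^2 <= (eps p_u)^2 and p_u <= 1 give x <= eps. *)
have small : ev (fun (eta : R) (n : nat) => eta <= eps * p u).
  exists (eps * p u); first exact: mulr_gt0.
  by move=> eta /andP[_ /ltW]; exists 0%N.
apply: ev_mono (ev_and small (ev_and (atomic_ev au) (atomic_ev av))).
move=> eta n eta0 [le [[uS pu] [vS _]]].
have vSu : v \in Sn n `\ u by rewrite in_fsetD1 eq_sym irr.
have := Re_res_neighbour (adjC G) theta eta0 uv uS vSu.
have := res_sqr_le (adjC G) theta eta vSu.
rewrite -/(r u eta n) -/(r2 u v eta n).
have := cabs_ge0 (r2 u v eta n); have := Re_res_ge0 (adjC G) theta eta vSu.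
rewrite -/(r2 u v eta n).
set x := cabs (r2 u v eta n); set y := Re _ => y0 x0 xy yr.
have h : x ^+ 2 * p u <= (eps * p u) ^+ 2.
  apply: (@le_trans _ _ (y * cabs (r u eta n))).
    by rewrite ler_pM ?sqr_ge0 // ltW.
  by rewrite (le_trans yr) // ler_pXn2r // nnegrE ?mulr_ge0 // ltW.
have {}h : x ^+ 2 <= eps ^+ 2.
  rewrite -(ler_pM2r p0) (le_trans h) // exprMn ler_wpM2l ?sqr_ge0 //.
  by rewrite expr2 ler_piMl // ltW.
by move: h; rewrite ler_pXn2r // nnegrE ltW.
Qed.

(** By [res_comm] the products r_u r_{u,v} and r_v r_{v,u} agree, and |r_v| is bounded below by
    [p v]. *)
Lemma ev0_sym u v : u != v -> atomic u -> atomic v ->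
  ev0 (fun eta n => cabs (r2 u v eta n)) -> ev0 (fun eta n => cabs (r2 v u eta n)).
Proof.
move=> uv au av h eps eps0; have [p0 p1 _] := av.
apply: ev_mono (ev_and (h _ (mulr_gt0 eps0 p0)) (ev_and (atomic_ev au) (atomic_ev av))).
move=> eta n eta0 [le [[uS pu] [vS pv]]].
have E := res_comm (adjC G) theta eta0 uv uS vS.
have {}E : cabs (r v eta n) * cabs (r2 v u eta n) = cabs (r u eta n) * cabs (r2 u v eta n).
  by rewrite -!cabsM /r /r2 -E.
rewrite -(ler_pM2r p0) mulrC (@le_trans _ _ (cabs (r v eta n) * cabs (r2 v u eta n))) //.
  by rewrite ler_wpM2r ?cabs_ge0.
rewrite E (le_trans _ le) // ler_piMl ?cabs_ge0 //.
by apply: cabs_res_le1 => //; apply: adjC.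
Qed.

Lemma ev0_trans u x y : u != x -> u != y -> x != y ->
  atomic u -> atomic x -> atomic y ->
  ev0 (fun eta n => cabs (r2 u y eta n)) -> ev0 (fun eta n => cabs (r2 x y eta n)) ->
  ev0 (fun eta n => cabs (r2 u x eta n)).
Proof.
move=> ux uy xy au ax ay huy hxy eps eps0.
have hyx := ev0_sym xy ax ay hxy.
have [pu0 pu1 _] := au; have [py0 py1 _] := ay.
(* With t = d, the right side of [res_triple_le] is at most d + 2d + (d + d) = 5d; the last d
   requires |r2 x y| <= d^2, because that term is divided by t. *)
pose d := p u * p y * eps / 5.
have d0 : 0 < d by rewrite divr_gt0 // !mulr_gt0.
apply: ev_mono (ev_and (ev_and (huy _ d0) (ev_and (hxy _ (exprn_gt0 2 d0)) (hyx _ d0)))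
  (ev_and (atomic_ev au) (ev_and (atomic_ev ax) (atomic_ev ay)))).
move=> eta n eta0 [[luy [lxy lyx]] [[uS pu] [[xS px] [yS py]]]].
have := res_triple_le (adjC G) theta eta0 d0 uS xS yS ux uy xy.
rewrite -/(r u eta n) -/(r y eta n) -/(r2 u x eta n) -/(r2 u y eta n)
  -/(r2 x y eta n) -/(r2 y x eta n) => h.
have Rxy : Re (r2 x y eta n) / d <= d.
  by rewrite ler_pdivrMr // -expr2 (le_trans (Re_le_cabs _)).
have {}h : p u * p y * cabs (r2 u x eta n) <= 5 * d.
  apply: (@le_trans _ _ (cabs (r u eta n) * cabs (r y eta n) * cabs (r2 u x eta n))).
    by rewrite ler_wpM2r ?cabs_ge0 // ler_pM // ltW.
  by apply: le_trans h _; lra.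
have pp : 0 < p u * p y by rewrite mulr_gt0.
by rewrite -(ler_pM2l pp) (le_trans h) // /d mulrC divfK.
Qed.

Variable u : nat.
Hypothesis all_atomic : forall v, comp G u v -> atomic v.

Lemma ev0_comp v : comp G u v -> v != u -> ev0 (fun eta n => cabs (r2 u v eta n)).
Proof.
move=> [s []]; elim/last_ind: s v => [|s x IH] v.
  by move=> _ /= <-; rewrite eqxx.
rewrite rcons_path last_rcons => /andP[ps sx] <-{v} xu.
have cy : comp G u (last u s) by exists s.
have cx : comp G u x by exists (rcons s x); rewrite rcons_path ps sx last_rcons.
have cu : comp G u u by exists [::].
(* The path may revisit [u]; then its last edge joins [u] to [x] directly. *)
have [yu|yu] := eqVneq (last u s) u.
  by apply: ev0_adj; [exact: all_atomic|exact: all_atomic|rewrite -yu].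
apply: (@ev0_trans u x (last u s)) => //; try exact: all_atomic.
- by rewrite eq_sym.
- by rewrite eq_sym.
- by rewrite eq_sym irr.
- exact: IH.
- by apply: ev0_adj; rewrite 1?adjC //; apply: all_atomic.
Qed.

(** 3 = 1 + (1 + 1): p_u, the constant of [res_sum_le], and the sum of the resolvents in S - u, each
    of which can be made small since [s] is finite. *)
Lemma sum_atoms_le (s : seq nat) : uniq s -> (forall v, v \in s -> comp G u v) ->
  \sum_(v <- s) p v <= 3.
Proof.
move=> us sc; have cu : comp G u u by exists [::].
pose s' := [seq v <- s | v != u].
have us' : uniq s' by rewrite filter_uniq.
have sc' v : v \in s' -> comp G u v by rewrite mem_filter => /andP[_ /sc].
have [pu0 pu1 _] := all_atomic cu.
apply: (@le_trans _ _ (p u + \sum_(v <- s') p v)).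
  rewrite /s' big_filter; have [us0|us0] := boolP (u \in s).
    by rewrite (bigD1_seq u).
  rewrite -[leLHS]add0r lerD ?(ltW pu0) // big_seq [leRHS]big_seq_cond.
  rewrite (eq_bigl (fun i => (i \in s) && (i != u))) // => v.
  by case: eqVneq => [->|]; rewrite ?(negPf us0) ?andbT.
pose d : R := (size s').+1%:R^-1; have d0 : 0 < d by rewrite invr_gt0.
have ev1 : ev (fun eta n => forall v, v \in s' ->
    cabs (r2 u v eta n) <= d /\ (v \in Sn n /\ p v <= cabs (r v eta n))).
  apply: ev_all => v vs; apply: ev_and.
    apply: ev0_comp => //; first exact: sc'.
    by move: vs; rewrite mem_filter => /andP[].
  by apply: atomic_ev; apply: all_atomic; apply: sc'.
have [eta [n [eta0 [hv [uS pu]]]]] := ev_ex (ev_and ev1 (atomic_ev (all_atomic cu))).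
have ss' : {subset s' <= Sn n `\ u}.
  move=> v vs; rewrite in_fsetD1; have [_ [-> _]] := hv v vs.
  by move: vs; rewrite mem_filter => /andP[->].
have := res_sum_le (adjC G) theta eta0 uS us' ss'.
have h1 : \sum_(v <- s') p v <= \sum_(v <- s') cabs (r v eta n).
  rewrite big_seq [leRHS]big_seq; apply: ler_sum => v /hv [_ [_]] //.
have h2 : \sum_(v <- s') cabs (r2 u v eta n) <= 1.
  apply: (@le_trans _ _ (\sum_(v <- s') d)).
    by rewrite big_seq [leRHS]big_seq; apply: ler_sum => v /hv [].
  rewrite big_const_seq iter_addr_0 count_predT -[leLHS]mulr_natl ler_pdivrMr //.
  by rewrite mul1r ler_nat.
rewrite -/(r _ eta n) => h3.
have -> : (3 : R) = 1 + (1 + 1) by ring.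
by apply: lerD => //; apply: (le_trans h1); apply: (le_trans h3); rewrite lerD2l.
Qed.

End CriticalGraph.

Local Close Scope fset_scope.

(** * Atoms of matching measures *)

Section PolynomialMoments.
Variables (R : realType) (nu : probability R R) (m : nat -> R) (d : R).
Hypothesis d_ge0 : 0 <= d.
Hypothesis nu_integrable : forall k, nu.-integrable setT (fun x : R => (x ^+ k)%:E).
Hypothesis nuE : forall k, (\int[nu]_x (x ^+ k)%:E)%E = (m k)%:E.
Hypothesis m_le : forall k, m k <= d ^+ k.

Lemma integral_horner (q : {poly R}) : (\int[nu]_x (q.[x])%:E)%E = (lmom m q)%:E.
Proof.
under eq_integral do rewrite horner_coef -sumEFin.
under eq_integral do under eq_bigr do rewrite EFinM.
rewrite integral_sum //; last by move=> i; apply: integrableZl.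
rewrite /lmom -sumEFin; apply: eq_bigr => i _.
by rewrite integralZl // nuE EFinM.
Qed.

Lemma lmom_ge0 (q : {poly R}) : (forall x, 0 <= q.[x]) -> 0 <= lmom m q.
Proof.
move=> q0; rewrite -lee_fin -integral_horner.
by apply: integral_ge0 => x _; rewrite lee_fin.
Qed.

(** Markov's inequality for even powers bounds the measure of |x| >= d + 1 by (d / (d + 1))^(2k) for
    every k. *)
Lemma ae_bounded : {ae nu, forall x : R, `|x| < d + 1}.
Proof.
set b := d + 1; have b0 : 0 < b by rewrite ltr_wpDl.
pose A := [set x : R | b <= `|x|].
have mA : measurable A.
  rewrite (_ : A = setT `&` (fun x : R => `|x|) @^-1` `[b, +oo[%classic)%classic.
    exact: normr_measurable.
  by apply/seteqP; split => x /=; rewrite in_itv /= andbT //; case.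
exists A; split => //; last first.
  by move=> x /= /negP; rewrite -leNgt.
have fA : nu A \is a fin_num by apply: fin_num_measure.
have le k : fine (nu A) <= ((d / b) ^+ 2) ^+ k.
  case: k => [|k]; first by rewrite -lee_fin fineK // probability_le1.
  have bk0 : 0 < b ^+ (2 * k.+1) by rewrite exprn_gt0.
  have := @le_integral_abse _ _ _ nu setT measurableT
     (fun x => (x ^+ (2 * k.+1))%:E) (b ^+ (2 * k.+1))
     (measurable_int _ (nu_integrable _)) bk0.
  have abseE (x : R) : (`|(x ^+ (2 * k.+1))%:E| = (x ^+ (2 * k.+1))%:E)%E.
    by rewrite /= ger0_norm // exprM exprn_ge0 // sqr_ge0.
  under [in X in (_ <= X)%E]eq_integral do rewrite abseE.
  rewrite nuE setTI (_ : [set x | _] = A); last first.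
    apply/seteqP; split => x /=; rewrite /A /= lee_fin normrX ler_pXn2r // ?nnegrE //;
      exact: ltW.
  move=> h; have {}h := le_trans h (_ : (_ <= (d ^+ (2 * k.+1))%:E)%E).
  have {}h : ((b ^+ (2 * k.+1))%:E * nu A <= (d ^+ (2 * k.+1))%:E)%E.
    by apply: h; rewrite lee_fin.
  rewrite -exprM expr_div_n ler_pdivlMr // mulrC -lee_fin EFinM fineK //.
have r1 : `|(d / b) ^+ 2| < 1.
  rewrite ger0_norm ?sqr_ge0 // expr_lt1 ?divr_ge0 ?(ltW b0) //.
  by rewrite ltr_pdivrMr // mul1r ltrDl.
apply/eqP; rewrite eq_le measure_ge0 andbT -(fineK fA) lee_fin.
by apply: (cvgr_to_ge (cvg_expr r1)); apply: nearW.
Qed.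

Variables (theta c : R).
Hypothesis c_gt : d + 1 + `|theta| < c.

(* Equal to 1 at [theta] and in (0, 1) elsewhere on the support of [nu], so that
   its powers converge to the indicator function of [theta]. *)
Definition spike : {poly R} := 1 - (c ^- 2) *: ('X - theta%:P) ^+ 2.

Lemma spikeE x : spike.[x] = 1 - ((x - theta) / c) ^+ 2.
Proof.
by rewrite /spike !hornerE /= exprMn exprVn; congr (_ - _); rewrite -mulrA mulrC.
Qed.

Lemma horner_bound (g : {poly R}) : exists K, forall x, `|x| < d + 1 -> `|g.[x]| <= K.
Proof.
exists (\sum_(i < size g) `|g`_i| * (d + 1) ^+ i) => x /ltW xb.
rewrite horner_coef (le_trans (ler_norm_sum _ _ _)) //; apply: ler_sum => i _.
by rewrite normrM normrX ler_wpM2l // lerXn2r // nnegrE // addr_ge0.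
Qed.

Lemma spike_bound x : `|x| < d + 1 -> 0 < spike.[x] <= 1.
Proof.
move=> xb; rewrite spikeE gerBl sqr_ge0 andbT subr_gt0.
have h : `|x - theta| < c.
  by rewrite (le_lt_trans (ler_normB _ _)) // (lt_trans _ c_gt) // ltrD2r.
have c0 : 0 < c := le_lt_trans (normr_ge0 _) h.
by rewrite -real_normK ?num_real // expr_lt1 // normf_div (gtr0_norm c0) ltr_pdivrMr // mul1r.
Qed.

Lemma spike_lt1 x : c != 0 -> x != theta -> spike.[x] < 1.
Proof.
move=> c0 xt; rewrite spikeE ltrBlDr ltrDl lt_def sqr_ge0 andbT sqrf_eq0.
by rewrite mulf_neq0 ?invr_eq0 // subr_eq0.
Qed.

(** Dominated convergence on the support. The factor [g] is carried along because the lower bound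
    needs the limit both for 1 and for (X - theta)^2 + eta^2. *)
Lemma lmom_spike (g : {poly R}) :
  lmom m (g * spike ^+ N) @[N --> \oo] --> g.[theta] * fine (nu [set theta]).
Proof.
have [K hK] := horner_bound g.
have c0 : c != 0 by rewrite gt_eqF // (le_lt_trans _ c_gt) // !addr_ge0.
pose f_ N x := ((g * spike ^+ N).[x])%:E.
pose f x := (g.[theta] * \1_[set theta] x)%:E.
have m1 : measurable [set theta] by exact: measurable_set1.
have := @dominated_convergence _ _ _ nu setT measurableT f_ f (fun=> K%:E).
case.
- by move=> N; apply/measurable_EFinP; apply: measurable_poly.
- apply/measurable_EFinP; apply: measurable_funM => //.
- apply: filterS ae_bounded => x xb _.
  rewrite /f_ /f indicE; apply: cvg_EFin; first exact: nearW.
  have [->|xt] := eqVneq x theta.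
    rewrite mem_set //= mulr1; under eq_fun => N do rewrite hornerM horner_exp spikeE subrr mul0r expr0n subr0 expr1n mulr1.
    exact: cvg_cst.
  rewrite memNset ?mulr0; last by move=> /= xe; rewrite xe eqxx in xt.
  under eq_fun => N do rewrite hornerM horner_exp.
  rewrite -(mulr0 g.[x]); apply: cvgMr; apply: cvg_expr.
  have /andP[s0 _] := spike_bound xb.
  by rewrite gtr0_norm // spike_lt1.
- exact: finite_measure_integrable_cst.
- apply: filterS ae_bounded => x xb N _.
  rewrite /f_ lee_fin hornerM normrM horner_exp normrX.
  have /andP[s0 s1] := spike_bound xb.
  rewrite -[leRHS]mulr1 ler_pM ?hK // exprn_ile1 //.
  by rewrite gtr0_norm.
have -> : [sequence (\int[nu]_x f_ n x)%E]_n =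
    (fun N => (lmom m (g * spike ^+ N))%:E).
  by apply/funext => N; apply: integral_horner.
have -> : (\int[nu]_x f x)%E = (g.[theta] * fine (nu [set theta]))%:E.
  rewrite /f; under eq_integral do rewrite EFinM.
  rewrite integralZl //; last exact: integrable_indic.
  by rewrite integral_indic // setIT EFinM fineK ?fin_num_measure.
by move=> _ _ /fine_cvgP[_].
Qed.

End PolynomialMoments.

Section Atoms.
Variables (R : realType) (theta : R) (D : nat).

(** [D.+1] is the moment growth rate of [tree_walks_le]; the final [+ 1] makes [c_gt] strict. *)
Definition spikeD : {poly R} := spike theta (D.+1%:R + 1 + `|theta| + 1).

(* For a graph of maximum degree at most [D] this is the mass of the atom
   [theta] of the matching measure. *)
Definition atom (G : graph) (u : nat) : \bar R :=
  limn_esup (fun N => (lmom (fun k => fine (path_tree_moment R G u k)) (spikeD ^+ N))%:E).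

Variable G : graph.
Hypothesis degG : max_deg_le D G 0.
Variable u : nat.
Hypothesis cu : comp G 0 u.
Variable nu : probability R R.
Hypothesis nuP : is_matching_measure G u nu.
Let m k := fine (path_tree_moment R G u k).

Let mE k : (\int[nu]_x (x ^+ k)%:E)%E = (m k)%:E.
Proof.
have [_ ->] := nuP k; rewrite /m /path_tree_moment fineK //.
by rewrite (tree_walks_fin R degG) //= eqxx.
Qed.

Lemma lmom_spikeD (g : {poly R}) :
  lmom m (g * spikeD ^+ N) @[N --> \oo] --> g.[theta] * fine (nu [set theta]).
Proof.
have vu : vpath G u [:: u] by rewrite /= eqxx.
apply: (@lmom_spike R nu m D.+1%:R) => //.
- by move=> k; have [] := nuP k.
- move=> k; rewrite -lee_fin /m /path_tree_moment fineK ?(tree_walks_fin R degG) //.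
  exact: tree_walks_le.
- by rewrite ltrDl.
Qed.

Lemma atomE : atom G u = nu [set theta].
Proof.
apply: (cvg_limn_einf_sup _).2.
rewrite -[nu _]fineK ?fin_num_measure //; apply: cvg_EFin; first exact: nearW.
have := @lmom_spikeD 1; rewrite hornerC mul1r.
by under eq_fun do rewrite mul1r.
Qed.

(** Apply [moment_bound] to [spikeD ^+ N]: as N grows the left side tends to eta^2 p^2 and the
    factor of the resolvent to eta^2 p, so the bound tends to p. Stopping at a finite N requires
    slack, here a factor 2. *)
Lemma atom_res_lower_bound (eta : R) : 0 < eta -> (0 < nu [set theta])%E ->
  exists n0, forall n, (n0 <= n)%N -> (u < n)%N /\
    fine (nu [set theta]) / 2 <= Re (res (adj G) theta eta (Sn n) u).
Proof.
move=> eta0 nu0; set p := fine (nu [set theta]).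
have p0 : 0 < p by rewrite -lte_fin fineK ?fin_num_measure.
pose w := 'X - theta%:P : {poly R}.
pose A N := lmom m (spikeD ^+ N).
pose B N := lmom m ((w * spikeD ^+ N) * (w * spikeD ^+ N)) +
   eta ^+ 2 * lmom m (spikeD ^+ N * spikeD ^+ N).
have cA : A N @[N --> \oo] --> p.
  have := @lmom_spikeD 1; rewrite hornerC mul1r.
  by under eq_fun do rewrite mul1r.
(* [B N] is the functional at (w^2 + eta^2) spike^(2N), and w vanishes at [theta]. *)
have cB : B N @[N --> \oo] --> eta ^+ 2 * p.
  have := @lmom_spikeD (w * w + (eta ^+ 2)%:P).
  rewrite !hornerE subrr mul0r add0r => h.
  have h2 : (fun N => lmom m ((w * w + (eta ^+ 2)%:P) * spikeD ^+ (2 * N))) @ \oo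
      --> eta ^+ 2 * p.
    apply: cvg_comp h => P [n0 _ hP]; exists n0 => // n /= le; apply: hP => /=.
    by rewrite (leq_trans le) // leq_pmull.
  apply: cvg_trans h2; apply: near_eq_cvg; apply: nearW => N.
  rewrite /B mulrDl lmomD mul_polyC lmomZ mul2n -addnn exprD.
  by congr (lmom _ _ + _); rewrite mulrACA.
have [N hN] : exists N, 0 < eta ^+ 2 * A N ^+ 2 - p / 2 * B N.
  have cC : (fun N => eta ^+ 2 * A N ^+ 2 - p / 2 * B N) @ \oo -->
      eta ^+ 2 * p ^+ 2 - p / 2 * (eta ^+ 2 * p).
    apply: cvgB; apply: cvgMr => //; under eq_fun do rewrite expr2.
    by rewrite expr2; apply: cvgM.
  have lt : 0 < eta ^+ 2 * p ^+ 2 - p / 2 * (eta ^+ 2 * p).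
    have -> : eta ^+ 2 * p ^+ 2 - p / 2 * (eta ^+ 2 * p) = (eta * p) ^+ 2 / 2.
      by field.
    by rewrite divr_gt0 // exprn_gt0 // mulr_gt0.
  by have [N hN] := filter_ex (cvgr_gt _ cC _ lt); exists N.
have B0 : 0 <= B N.
  have sq0 (g : {poly R}) : 0 <= lmom m (g * g).
    apply: (@lmom_ge0 R nu) => // [k|x]; first by have [] := nuP k.
    by rewrite hornerM -expr2 sqr_ge0.
  by rewrite addr_ge0 // mulr_ge0 // sqr_ge0.
have [n0 hn0] := @moment_bound R G D degG u cu (size (spikeD ^+ N)%R).
exists n0 => n /hn0[un /(_ theta eta (spikeD ^+ N) eta0 (leqnn _))] h.
split=> //; have {}h : p / 2 * B N < Re (res (adj G) theta eta (Sn n) u) * B N.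
  by rewrite (lt_le_trans _ h) // -subr_gt0.
by rewrite leNgt; apply: contraTN h => h; rewrite -leNgt ler_wpM2r // ltW.
Qed.

End Atoms.

(** * Mass transport *)

Section Isomorphism.
Variables (R : realType) (theta : R) (G G' : graph) (a a' b b' : nat).

(** Induction on the walk length. Sums over children become sums over sets, since [phi] need not
    respect the order of [nat]; all paths met stay in the component, where [phi] is controlled. *)
Lemma tree_walks_iso (phi : nat -> nat) :
  (forall v, comp G a v -> comp G' a' (phi v)) ->
  (forall w, comp G' a' w -> exists2 v, comp G a v & phi v = w) ->
  (forall v w, comp G a v -> comp G a w -> phi v = phi w -> v = w) ->
  (forall v w, comp G a v -> comp G a w -> adj G' (phi v) (phi w) = adj G v w) ->
  comp G a b -> forall k p, (forall x, x \in p -> comp G a x) ->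
  tree_walks R G' (phi b) k (map phi p) = tree_walks R G b k p.
Proof.
move=> phiT phiS phiI phiA cb; elim=> [|k IH] p cp /=.
  suff -> : (map phi p == [:: phi b]) = (p == [:: b]) by [].
  apply/eqP/eqP => [|-> //]; case: p cp => [|x [|y p]] //= cp [xb].
  by rewrite (phiI x b) //; apply: cp; rewrite mem_head.
rewrite size_map behead_map; congr (_ + _)%E.
  case: ifP => // _; apply: IH => x xp; apply: cp.
  by case: p xp => //= y p xp; rewrite inE xp orbT.
have ch : comp G a (head b p) by case: p cp => //= x p; apply; rewrite mem_head.
have -> : head (phi b) (map phi p) = phi (head b p) by case: (p).
set h := head b p in ch *.
rewrite -(eseries_mkcond (fun x => tree_walks R G' (phi b) k (x :: map phi p))).
rewrite -(eseries_mkcond (fun x => tree_walks R G b k (x :: p))).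
rewrite !nneseries_esum; try by move=> *; apply: tree_walks_ge0.
rewrite (reindex_esum [set x | adj G h x && (x \notin p)] _ phi).
  apply: eq_esum => x /= /andP[hx _]; rewrite -(IH (x :: p)) //= => y.
  by rewrite inE => /predU1P[->|/cp //]; apply: comp_adj hx.
have mem_phi x : comp G a x -> (phi x \in map phi p) = (x \in p).
  move=> cx; apply/mapP/idP => [[y yp /(phiI _ _ cx (cp _ yp)) ->]//|xp].
  by exists x.
split.
- move=> x /= /andP[hx xp]; have cx := comp_adj ch hx.
  by rewrite phiA // hx mem_phi.
- by move=> x y; rewrite !inE => /andP[/(comp_adj ch) cx _] /andP[/(comp_adj ch) cy _]; apply: phiI.
- move=> w /= /andP[hw wp]; have [x cx xw] := phiS _ (comp_adj (phiT _ ch) hw).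
  by exists x => //=; rewrite -mem_phi // xw wp andbT -phiA // xw.
Qed.

Lemma atom_iso D : comp G a b -> birooted_iso G a b G' a' b' ->
  atom theta D G b = atom theta D G' b'.
Proof.
move=> cb [phi [phiT [phiS [phiI [phiA [_ <-]]]]]]; rewrite /atom.
congr limn_esup; apply/funext => N; congr (_%:E).
apply: eq_lmom => k _; congr fine; rewrite /path_tree_moment.
rewrite -(@tree_walks_iso phi phiT phiS phiI phiA cb k [:: b]) // => x.
by rewrite inE => /eqP ->.
Qed.

End Isomorphism.

(** * Measurability along a graph-valued map [Gr], for use on both [graphM] and [bigraphM] *)

Section Measurability.
Context d (T : measurableType d) (R : realType) (Gr : T -> graph).
Hypothesis mGr : forall i j, measurable [set t | Gr t i j].

Lemma measurable_adj i j : measurable [set t | adj (Gr t) i j].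
Proof.
rewrite /adj; case: eqP => _ /=.
  by rewrite (_ : [set _ | _] = set0) //; apply/seteqP; split.
rewrite (_ : [set _ | _] = [set t | Gr t i j] `|` [set t | Gr t j i]).
  exact: measurableU.
by apply/seteqP; split => t /=; [move=> /orP | case=> ->; rewrite ?orbT].
Qed.

Lemma measurable_path u s : measurable [set t | path (adj (Gr t)) u s].
Proof.
elim: s u => [|x s IH] u /=; first by rewrite (_ : [set _ | _] = setT) //; apply/seteqP; split.
rewrite (_ : [set _ | _] = [set t | adj (Gr t) u x] `&` [set t | path (adj (Gr t)) x s]).
  by apply: measurableI => //; apply: measurable_adj.
by apply/seteqP; split => t /=; [move=> /andP | case=> -> ->].
Qed.

Lemma measurable_comp u v : measurable [set t | comp (Gr t) u v].
Proof.
rewrite (_ : [set _ | _] = \bigcup_s [set t | path (adj (Gr t)) u s /\ last u s = v]).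
  apply: countable_bigcupT_measurable => // s.
  have [<-|uv] := eqVneq (last u s) v.
    rewrite (_ : [set _ | _] = [set t | path (adj (Gr t)) u s]).
      exact: measurable_path.
    by apply/seteqP; split => t /=; [case|].
  rewrite (_ : [set _ | _] = set0) //; apply/seteqP; split => t //= -[_ E].
  by rewrite E eqxx in uv.
by apply/seteqP; split => t; [case=> s h; exists s | case=> s _ h; exists s].
Qed.

Lemma measurable_if_set (A : set T) (f : T -> \bar R) : measurable A ->
  measurable_fun setT f -> measurable_fun setT (fun t => if t \in A then f t else 0%E).
Proof.
move=> mA mf; apply: measurable_fun_ifT => //.
apply: (@measurable_fun_bool _ _ _ _ true).
rewrite setTI (_ : _ @^-1` _ = A) //; apply/seteqP; split => t /=; first by move=> /set_mem.
by move=> At; rewrite mem_set.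
Qed.

Lemma measurable_tree_walks u k p :
  measurable_fun setT (fun t => tree_walks R (Gr t) u k p).
Proof.
elim: k p => [|k IH] p /=; first by case: (p == _).
apply: emeasurable_funD; first by case: (1 < size p)%N.
apply: (@ge0_emeasurable_sum _ _ _ _ _ xpredT).
  by move=> x t _ _; case: ifP => // _; apply: tree_walks_ge0.
move=> x _; have [xp|xp] := boolP (x \in p).
  rewrite (_ : (fun t => _) = cst 0%E); first exact: measurable_cst.
  by apply/funext => t; rewrite andbF.
rewrite (_ : (fun t => _) = (fun t => if t \in [set t | adj (Gr t) (head u p) x]
   then tree_walks R (Gr t) u k (x :: p) else 0%E)).
  by apply: measurable_if_set => //; apply: measurable_adj.
apply/funext => t; rewrite andbT; congr (if _ then _ else _).
by apply/idP/idP => [h|/set_mem//]; rewrite mem_set.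
Qed.

Lemma measurable_atom theta D u : measurable_fun setT (fun t => atom theta D (Gr t) u : \bar R).
Proof.
apply: measurable_fun_limn_esup => N; apply/measurable_EFinP.
apply: measurable_sum => i; apply: measurable_funM => //.
apply: (measurableT_comp (fine_measurable measurableT)).
exact: measurable_tree_walks.
Qed.

End Measurability.

Section CriticalAtoms.
Variables (R : realType) (theta : R) (D : nat) (G : graph).
Hypotheses (degG : max_deg_le D G 0) (critG : critical theta G).

Lemma atom_gt0 u : comp G 0 u -> (0 < atom theta D G u)%E.
Proof. by move=> cu; have [nu [nuP nu0]] := critG cu; rewrite (atomE theta degG cu nuP). Qed.

Lemma atom_fin u : comp G 0 u -> atom theta D G u \is a fin_num.
Proof.
by move=> cu; have [nu [nuP nu0]] := critG cu; rewrite (atomE theta degG cu nuP) fin_num_measure.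
Qed.

(** [sum_atoms_le] is applied to half the atoms, hence 6 = 2 * 3. *)
Lemma critical_sum_atoms (s : seq nat) : uniq s -> (forall v, v \in s -> comp G 0 v) ->
  \sum_(v <- s) fine (atom theta D G v) <= 6.
Proof.
move=> us sc.
have := @sum_atoms_le R theta G (fun v => fine (atom theta D G v) / 2) 0 _ s us sc.
rewrite -mulr_suml ler_pdivrMr // (_ : 3 * 2 = 6 :> R); last by ring.
apply=> v cv; have [nu [nuP nu0]] := critG cv; rewrite (atomE theta degG cv nuP).
have p0 : 0 < fine (nu [set theta]) by rewrite -lte_fin fineK ?fin_num_measure.
have p1 : fine (nu [set theta]) <= 1 by rewrite -lee_fin fineK ?fin_num_measure ?probability_le1.
split; [by rewrite divr_gt0|by rewrite ler_pdivrMr // mul1r (le_trans p1) // ler1n|].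
by move=> eta eta0; apply: (atom_res_lower_bound degG cv nuP).
Qed.

Lemma critical_nneseries_atoms :
  (\sum_(v <oo) (if v \in comp G 0 then maxe 0%E (atom theta D G v) else 0) <= 6%:E)%E.
Proof.
apply: lime_le; first by apply: is_cvg_nneseries => v _ _; case: ifP => // _; rewrite le_max lexx.
apply: nearW => n; rewrite -big_mkcond -big_filter.
set s := [seq v <- index_iota 0 n | v \in comp G 0].
have sc v : v \in s -> comp G 0 v by rewrite mem_filter => /andP[/set_mem].
rewrite (eq_big_seq (fun v => (fine (atom theta D G v))%:E)); last first.
  by move=> v /sc cv; rewrite fineK ?atom_fin // max_r // ltW // atom_gt0.
by rewrite sumEFin lee_fin critical_sum_atoms // filter_uniq // iota_uniq.
Qed.

End CriticalAtoms.

Lemma finite_of_nneseries_cst (R : realType) (A : set nat) (c : R) : 0 < c ->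
  (\sum_(v <oo) (if v \in A then c%:E else 0))%E \is a fin_num -> finite_set A.
Proof.
move=> c0 Xfin; apply: contrapT => infA.
pose f v : \bar R := if v \in A then c%:E else 0%E.
have f0 v : (0 <= f v)%E by rewrite /f; case: ifP => // _; rewrite lee_fin ltW.
pose x := fine (\sum_(v <oo) f v)%E.
have xE : x%:E = (\sum_(v <oo) f v)%E := fineK Xfin.
have x0 : 0 <= x by rewrite -lee_fin xE nneseries_ge0.
have [B BA MB] := infinite_set_fset (Num.bound (x / c)) infA.
pose n := (\max_(v <- B) v.+1)%N.
have sub : {subset B <= [seq v <- index_iota 0 n | v \in A]}.
  move=> v vB; rewrite mem_filter mem_index_iota /= mem_set /=; last exact: BA.
  by rewrite /n (big_rem v) //= leq_maxl.
have le : c * (size [seq v <- index_iota 0 n | v \in A])%:R <= x.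
  rewrite -lee_fin xE; apply: le_trans (nneseries_lim_ge n _); last by move=> *; apply: f0.
  rewrite /f -big_mkcond sumEFin lee_fin big_const_seq iter_addr_0.
  by rewrite -size_filter mulr_natr.
have : x < c * (Num.bound (x / c))%:R.
  by rewrite mulrC -ltr_pdivrMr // archi_boundP // divr_ge0 // ltW.
rewrite ltNge (le_trans _ le) // ler_wpM2l ?(ltW c0) // ler_nat (leq_trans MB) //.
exact: uniq_leq_size (fset_uniq _) sub.
Qed.

Lemma measurable_graph_entry i j : measurable [set G : graphM | G i j].
Proof. by apply: sub_sigma_algebra; exists i, j, true. Qed.

Lemma measurable_bigraph_entry i j : measurable [set x : bigraphM | x.1.1 i j].
Proof. by apply: sub_sigma_algebra; left; exists i, j, true. Qed.

Lemma measurable_bigraph_target n : measurable [set x : bigraphM | x.2 = n].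
Proof. by apply: sub_sigma_algebra; right; right; exists n. Qed.

Section MassTransport.
Variables (R : realType) (theta : R) (D : nat).

(** Unimodularity is tested on functions nonnegative on every graph, and an upper limit of formal
    moments need not be so a priori; hence the maximum with 0. *)
Definition transport (x : bigraphM) : \bar R := maxe 0%E (atom theta D x.1.1 x.2).

Lemma measurable_transport : measurable_fun setT transport.
Proof.
move=> _ Y mY; rewrite setTI.
(* The vertex argument of [atom] varies with the point; splitting by its value leaves only the graph
   varying. *)
rewrite (_ : _ @^-1` _ = \bigcup_n ([set x : bigraphM | x.2 = n] `&`
   (setT `&` (fun x : bigraphM => maxe 0%E (atom theta D x.1.1 n)) @^-1` Y))).
  apply: bigcupT_measurable => n; apply: measurableI; first exact: measurable_bigraph_target.
  have mf : measurable_fun setT (fun x : bigraphM => maxe 0%E (atom theta D x.1.1 n)).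
    apply: measurable_maxe => //.
    exact: (measurable_atom (Gr := fun x : bigraphM => x.1.1) measurable_bigraph_entry).
  exact: mf.
apply/seteqP; split => x /=; first by move=> Yx; exists x.2.
by case=> n _ [/= <- [_]].
Qed.

Lemma transport_ge0 x : (0 <= transport x)%E.
Proof. by rewrite le_max lexx. Qed.

Lemma transport_iso : iso_invariant (transport : bigraph -> \bar R).
Proof.
move=> G a b G' a' b' cb iso; rewrite /transport /=; congr maxe.
exact: atom_iso iso.
Qed.

(* The mass sent by the root for [w = id], the mass it receives for [w = 0]. *)
Definition mass (w : nat -> nat) (G : graphM) : \bar R :=
  (\sum_(v <oo) (if v \in comp G 0 then maxe 0 (atom theta D G (w v)) else 0))%E.

Let mass_term_ge0 (b : bool) (x : \bar R) : (0 <= if b then maxe 0 x else 0)%E.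
Proof. by case: b => //; rewrite le_max lexx. Qed.

Lemma mass_ge0 w G : (0 <= mass w G)%E.
Proof. by apply: nneseries_ge0 => v _ _; apply: mass_term_ge0. Qed.

Lemma measurable_mass w : measurable_fun setT (mass w).
Proof.
apply: (@ge0_emeasurable_sum _ _ _ _ _ xpredT); first by move=> *; apply: mass_term_ge0.
move=> v _.
rewrite (_ : (fun G => _) = (fun G : graphM => if G \in [set G : graphM | comp G 0 v]
   then maxe 0%E (atom theta D G (w v)) else 0%E)).
  apply: measurable_if_set.
    exact: (measurable_comp (Gr := fun G : graphM => G) measurable_graph_entry).
  apply: measurable_maxe; first exact: measurable_cst.
  exact: (measurable_atom (Gr := fun G : graphM => G) measurable_graph_entry).
by apply/funext => G.
Qed.

(** Every vertex sends the root the same positive amount, so the mass received is that amount times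
    the number of vertices. *)
Lemma finite_of_mass G : max_deg_le D G 0 -> critical theta G ->
  mass (fun=> 0%N) G \is a fin_num -> finite_graph G.
Proof.
move=> degG critG; have c0 : comp G 0 0 by exists [::].
have a0 := atom_gt0 degG critG c0; have afin := atom_fin degG critG c0.
rewrite /mass max_r ?(ltW a0) // -(fineK afin); apply: finite_of_nneseries_cst.
by rewrite -lte_fin fineK.
Qed.

End MassTransport.

Lemma integral_cst_probability d (T : measurableType d) (R : realType)
  (P : probability T R) (c : R) : (\int[P]_x cst c%:E x)%E = c%:E.
Proof.
rewrite integral_cst //; transitivity (c%:E * 1)%E; last by rewrite mule1.
by congr (_ * _)%E; apply: probability_setT.
Qed.

Theorem theorem1p10 (R : realType) (theta : R) (D : nat)
  (P : probability graphM R) :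
  unimodular P ->
  {ae P, forall G : graphM, max_deg_le D G 0} ->
  {ae P, forall G : graphM, critical theta G} ->
  {ae P, forall G : graphM, finite_graph G}.
Proof.
move=> uniP degP critP.
(* As [transport] depends on its second root only, the two sides of unimodularity are by conversion
   the expected masses sent and received by the root. *)
have XY : (\int[P]_G mass theta D id G = \int[P]_G mass theta D (fun=> 0%N) G)%E :=
  uniP _ (measurable_transport theta D) (transport_ge0 theta D) (@transport_iso R theta D).
have Y6 : (\int[P]_G mass theta D id G <= 6%:E)%E.
  rewrite -(integral_cst_probability P 6); apply: ae_ge0_le_integral.
  - exact: measurableT.
  - by move=> G _; apply: mass_ge0.
  - exact: measurable_mass.
  - by move=> G _; rewrite lee_fin.
  - exact: measurable_cst.
  - apply: filterS2 degP critP => G degG critG _; exact: critical_nneseries_atoms.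
have Xint : P.-integrable setT (mass theta D (fun=> 0%N)).
  apply/integrableP; split; first exact: measurable_mass.
  have -> : (\int[P]_G `|mass theta D (fun=> 0%N) G| =
            \int[P]_G mass theta D (fun=> 0%N) G)%E.
    by apply: eq_integral => G _; apply: gee0_abs; apply: mass_ge0.
  by rewrite -XY; apply: le_lt_trans Y6 _; apply: ltry.
apply: filterS3 degP critP (integrable_ae measurableT Xint) => G degG critG /(_ I).
exact: finite_of_mass degG critG.
Qed.
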